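(* Let $|\gamma|<1$. Let $c\in\mathfrak D_{\mathcal M_{\theta_\gamma}^*}$ and $c_1\in\mathfrak D_{\mathcal M_{\theta_\gamma}}$ be unit vectors, and let $\Phi_\gamma^*:L^2(\mu)\to\mathcal K_{\theta_\gamma}$ be a unitary operator with $\Phi_\gamma^*U_\gamma=\mathcal M_{\theta_\gamma}\Phi_\gamma^*$, $\Phi_\gamma^*b=c$ and $\Phi_\gamma^*b_1=c_1$. Then for all $f\in C^1(\mathbb T)$, $$\Phi_\gamma^*f(z)=A_\gamma(z)f(z)+B_\gamma(z)\int_{\mathbb T}\frac{f(\xi)-f(z)}{1-\overline\xi z}\,d\mu(\xi)\qquad\text{a.e. }z\in\mathbb T,$$ where $A_\gamma(z)=c(z)$ and $B_\gamma(z)=c(z)-zc_1(z)$.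
   Context: $\mathbb T=\{|z|=1\}$, $\mathbb D$ the open unit disc. Let $\mu$ be a Borel probability measure on $\mathbb T$, $U=M_\xi$ multiplication by the independent variable on $L^2(\mu)$, $b=\mathbf 1$, $b_1=U^*b$ ($b_1(\xi)=\overline\xi$). For $|\gamma|<1$, $U_\gamma=U+(\gamma-1)(\,\cdot\,,b_1)_{L^2(\mu)}b$, a completely non-unitary contraction. For $\lambda\in\mathbb D$ let $R_2\mu(\lambda)=\int_{\mathbb T}\frac{1+\overline\xi\lambda}{1-\overline\xi\lambda}d\mu(\xi)$ and $\theta_\gamma(\lambda)=\frac{(1-\gamma)R_2\mu(\lambda)-(1+\gamma)}{(1-\overline\gamma)R_2\mu(\lambda)+(1+\overline\gamma)}$ (the characteristic function of $U_\gamma$); $\theta_\gamma$ also denotes its a.e. boundary values on $\mathbb T$, and $\Delta_\gamma=(1-|\theta_\gamma|^2)^{1/2}$ on $\mathbb T$. The (Sz.-Nagy–Foiaş) model space is $\mathcal K_{\theta}=\big(H^2\oplus\operatorname{clos}\Delta L^2\big)\ominus\{(\theta h,\Delta h):h\in H^2\}\subset L^2(\mathbb T;\mathbb C^2)$ (normalized Lebesgue measure), with $\theta=\theta_\gamma$, $\Delta=\Delta_\gamma$; the model operator is $\mathcal M_{\theta}=P_{\mathcal K_\theta}M_z|_{\mathcal K_\theta}$, $M_z$ being entrywise multiplication by $z$. For a contraction $T$, $\mathfrak D_T=\operatorname{clos}\operatorname{Ran}(I-T^*T)^{1/2}$ and $\mathfrak D_{T^*}=\operatorname{clos}\operatorname{Ran}(I-TT^*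 )^{1/2}$. *)

(* Defs.v *)
(* MathComp + MathComp-Analysis; complex numbers are mathcomp-real-closed's R[i]. *)
From HB Require Import structures.
From mathcomp Require Import all_boot all_order all_algebra.
From mathcomp Require Import all_classical all_reals all_analysis.
From mathcomp Require Import complex.
Set Implicit Arguments. Unset Strict Implicit. Unset Printing Implicit Defensive.
Import Order.TTheory GRing.Theory Num.Theory.
Import numFieldNormedType.Exports.
Local Open Scope ring_scope.
Local Open Scope classical_set_scope.

Section Defs.
Variable R : realType.
Local Notation C := R[i].

(** Points of the unit circle are parametrized by angles t in [0, 2 pi[ ;
    the point is expi t = e^{it}. *)
Definition cRe (z : C) : R := complex.Re z.
Definition cIm (z : C) : R := complex.Im z.
Definition expi (t : R) : C := Complex (cos t) (sin t).
Definition sqn (z : C) : R := cRe z ^+ 2 + cIm z ^+ 2.   (* |z|^2 *)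
Definition circ : set (measurableTypeR R) := `[0, 2 * pi[.

(** integral over T of a complex valued function, w.r.t. a measure on angles *)
Definition cint (mu : {measure set (measurableTypeR R) -> \bar R}) (h : R -> C) : C :=
  Complex (Rintegral mu circ (cRe \o h)) (Rintegral mu circ (cIm \o h)).
Definition lebm : {measure set (measurableTypeR R) -> \bar R} := @lebesgue_measure R.
(** integral w.r.t. normalized Lebesgue measure m on T *)
Definition cintm (h : R -> C) : C := (Complex (2 * pi)^-1 0) * cint lebm h.

(** f is (a representative of) an element of L^2(mu) *)
Definition L2 (mu : {measure set (measurableTypeR R) -> \bar R}) (f : R -> C) : Prop :=
  measurable_fun circ (cRe \o f) /\ measurable_fun circ (cIm \o f) /\
  mu.-integrable circ (fun t => (sqn (f t))%:E).

Definition ipmu (mu : {measure set (measurableTypeR R) -> \bar R}) (f g : R -> C) : C :=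
  cint mu (fun t => f t * (g t)^*).
Definition ipm (f g : R -> C) : C := cintm (fun t => f t * (g t)^*).

(** scalar functions: operations *)
Definition fadd (f g : R -> C) : R -> C := fun t => f t + g t.
Definition fscl (a : C) (f : R -> C) : R -> C := fun t => a * f t.

(** C^2-valued functions on T *)
Definition V2 := ((R -> C) * (R -> C))%type.
Definition add2 (x y : V2) : V2 := (fadd x.1 y.1, fadd x.2 y.2).
Definition scl2 (a : C) (x : V2) : V2 := (fscl a x.1, fscl a x.2).
Definition ip2 (x y : V2) : C := ipm x.1 y.1 + ipm x.2 y.2.

(** Generic Hilbert-space notions on representatives, for a type V with
    addition, scalar multiplication and a (semi-)inner product ip. *)
Section Generic.
Variables (V : Type) (add : V -> V -> V) (scl : C -> V -> V) (ip : V -> V -> C).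
Definition vsub (x y : V) : V := add x (scl (-1) y).
Definition nrm2 (x : V) : R := cRe (ip x x).
(** equality in the Hilbert space (equality a.e.) *)
Definition eqv (x y : V) : Prop := nrm2 (vsub x y) = 0.
(** p is the orthogonal projection of x onto the closed subspace S *)
Definition isproj (S : V -> Prop) (x p : V) : Prop :=
  S p /\ forall y, S y -> ip (vsub x p) y = 0.
(** T is a (well defined, linear) operator on S *)
Definition is_op (S : V -> Prop) (T : V -> V) : Prop :=
  (forall x, S x -> S (T x)) /\
  (forall x y, S x -> S y -> eqv x y -> eqv (T x) (T y)) /\
  (forall a x y, S x -> S y -> eqv (T (add (scl a x) y)) (add (scl a (T x)) (T y))).
(** Ts is the adjoint of T on S *)
Definition adjoint (S : V -> Prop) (T Ts : V -> V) : Prop :=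
  is_op S Ts /\ forall x y, S x -> S y -> ip (T x) y = ip x (Ts y).
(** Q is a positive square root of the operator A on S *)
Definition possqrt (S : V -> Prop) (A Q : V -> V) : Prop :=
  is_op S Q /\
  (forall x, S x -> cIm (ip (Q x) x) = 0 /\ 0 <= cRe (ip (Q x) x)) /\
  (forall x, S x -> eqv (Q (Q x)) (A x)).
(** c lies in the closure of the set P *)
Definition inclos (P : V -> Prop) (c : V) : Prop :=
  forall e : R, 0 < e -> exists x, P x /\ nrm2 (vsub c x) < e.
(** c in D_T = clos Ran (I - Tstar T)^{1/2} *)
Definition defect (S : V -> Prop) (T : V -> V) (c : V) : Prop :=
  S c /\ exists Ts Q, adjoint S T Ts /\
    possqrt S (fun x => vsub x (Ts (T x))) Q /\
    inclos (fun y => exists x, S x /\ y = Q x) c.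
(** c in D_{Tstar} = clos Ran (I - T Tstar)^{1/2} *)
Definition defect_star (S : V -> Prop) (T : V -> V) (c : V) : Prop :=
  S c /\ exists Ts Q, adjoint S T Ts /\
    possqrt S (fun x => vsub x (T (Ts x))) Q /\
    inclos (fun y => exists x, S x /\ y = Q x) c.
End Generic.

(** H^2: L^2(m) functions whose negative Fourier coefficients vanish *)
Definition H2 (h : R -> C) : Prop :=
  L2 lebm h /\ forall n : nat, (0 < n)%N -> cintm (fun t => h t * expi (n%:R * t)) = 0.

(** the model space K_theta, for boundary function th and Delta = dl *)
Definition Kth (th dl : R -> C) (g : V2) : Prop :=
  H2 g.1 /\ L2 lebm g.2 /\
  (forall e : R, 0 < e -> exists h, L2 lebm h /\
       nrm2 ipm (vsub fadd fscl g.2 (fun t => dl t * h t)) < e) /\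
  (forall h, H2 h -> ip2 g (fun t => th t * h t, fun t => dl t * h t) = 0).

(** entrywise multiplication by z *)
Definition zmul (g : V2) : V2 := (fun t => expi t * g.1 t, fun t => expi t * g.2 t).

(** b = 1, b1 = conj xi, U_gamma *)
Definition bvec : R -> C := fun _ => 1.
Definition b1vec : R -> C := fun t => (expi t)^*.
Definition Ugam (mu : {measure set (measurableTypeR R) -> \bar R}) (gam : C) (f : R -> C) : R -> C :=
  fun t => expi t * f t + (gam - 1) * ipmu mu f b1vec * bvec t.

(** R_2 mu and theta_gamma on the disc *)
Definition R2mu (mu : {measure set (measurableTypeR R) -> \bar R}) (lam : C) : C :=
  cint mu (fun s => (1 + (expi s)^* * lam) / (1 - (expi s)^* * lam)).
Definition thetag (mu : {measure set (measurableTypeR R) -> \bar R}) (gam lam : C) : C :=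
  ((1 - gam) * R2mu mu lam - (1 + gam)) / ((1 - gam^*) * R2mu mu lam + (1 + gam^*)).

(** th is the a.e. (radial) boundary function of theta_gamma *)
Definition is_boundary (mu : {measure set (measurableTypeR R) -> \bar R}) (gam : C) (th : R -> C) : Prop :=
  {ae lebm, forall t, circ t -> forall e : R, 0 < e -> exists2 d : R, 0 < d &
     forall r : R, 1 - d < r < 1 ->
       sqn (thetag mu gam (Complex r 0 * expi t) - th t) < e}.

Definition Deltaf (th : R -> C) : R -> C := fun t => Complex (Num.sqrt (1 - sqn (th t))) 0.

(** C^1(T): 2 pi-periodic, real and imaginary parts C^1 *)
Definition C1T (f : R -> C) : Prop :=
  (forall t, f (t + 2 * pi) = f t) /\
  (forall t, derivable (cRe \o f) t 1) /\ continuous ((cRe \o f)^`() : R -> R) /\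
  (forall t, derivable (cIm \o f) t 1) /\ continuous ((cIm \o f)^`() : R -> R).

(** the Cauchy-type integral  int (f xi - f z)/(1 - conj xi z) dmu(xi), z = expi t *)
Definition Jint (mu : {measure set (measurableTypeR R) -> \bar R}) (f : R -> C) (t : R) : C :=
  cint mu (fun s => (f s - f t) / (1 - (expi s)^* * expi t)).

End Defs.

(* Main.v *)
(** On the orthogonal complement of [b1] the operator [U_gam] is multiplication by
    [xi], hence isometric; so its unitary image, the compression of multiplication
    by [z] to the model space, is isometric there too, and a compression can only be
    isometric where it does not project at all. Splitting off the component of [f]
    along [b1] therefore gives
      [Phi (xi f) = z Phi f + (f, b1) (c - z c1)].
    The right-hand side of the representation formula obeys the same recursion at
    every [z] which is not an atom of [mu], so the formula propagates from [1] to all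
    trigonometric polynomials. These are dense in [C^1]: one approximates the
    derivative uniformly by discrete Fejer sums and integrates. If the squared
    difference quotients [|f s - f t|^2 / |1 - e^{i(t - s)}|^2] are at most [K], the
    Cauchy-type integral of [f] has squared modulus at most [2 K], so the formula
    survives the limit. *)
Require Import Defs.
From HB Require Import structures.
From mathcomp Require Import all_boot all_order all_algebra.
From mathcomp Require Import all_classical all_reals all_analysis.
From mathcomp Require Import measurable_realfun complex ring lra.
Import Order.TTheory GRing.Theory Num.Theory.
Import numFieldNormedType.Exports.
Local Open Scope ring_scope.
Local Open Scope classical_set_scope.

(** * The Fejer kernel and its sums over equidistant nodes *)

Section Fejer.
Variable R : realType.
Implicit Types (x y t : R) (k l m N : nat).

(** The Fejer kernel as $m^{-1}|\sum_{k<m} e^{ikx}|^2$ in real and imaginary parts, a form that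
    makes it visibly nonnegative. *)
Definition fejer m x : R :=
  m%:R^-1 * ((\sum_(k < m) cos (k%:R * x)) ^+ 2 +
             (\sum_(k < m) sin (k%:R * x)) ^+ 2).

Lemma fejer_ge0 m x : 0 <= fejer m x.
Proof. by rewrite mulr_ge0 ?invr_ge0 ?addr_ge0 ?sqr_ge0. Qed.

Lemma fejerE m x :
  fejer m x = m%:R^-1 * \sum_(k < m) \sum_(l < m) cos (k%:R * x - l%:R * x).
Proof.
congr (_ * _); rewrite !expr2 !big_distrlr /= -big_split /=.
apply: eq_bigr => k _; rewrite -big_split /=.
by apply: eq_bigr => l _; rewrite cosB.
Qed.

Definition fejer_node N j : R := 2 * pi * j%:R / N%:R.

(** Half the angular step of the telescoping sum below stays inside $(0,\pi)$, where the sine does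
    not vanish. *)
Lemma natdiff_bound k l N : (k < N)%N -> (l < k)%N ->
  0 < (k%:R - l%:R) / N%:R * (pi : R) < pi.
Proof.
move=> kN lk; have N0 : (0 : R) < N%:R by rewrite ltr0n (leq_ltn_trans _ kN).
have p0 := pi_gt0 R.
have d0 : 0 < k%:R - l%:R :> R by rewrite subr_gt0 ltr_nat.
have dN : k%:R - l%:R < N%:R :> R.
  by rewrite (@le_lt_trans _ _ k%:R) ?ltr_nat// lerBlDr lerDl ler0n.
by rewrite mulr_gt0 ?divr_gt0//= gtr_pMl// ltr_pdivrMr// mul1r.
Qed.

(* Multiplied by [2 sin a], with [2 a] the angular step, the sum telescopes. *)
Lemma sum_cos_node k l N x : (l < k)%N -> (k < N)%N ->
  \sum_(j < N) cos (k%:R * (x - fejer_node N j) - l%:R * (x - fejer_node N j)) = 0.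
Proof.
move=> lk kN; have N0 : (N%:R : R) != 0.
  by rewrite pnatr_eq0 -lt0n (leq_ltn_trans _ kN).
pose a : R := (k%:R - l%:R) / N%:R * pi.
have sa : sin a != 0 by rewrite gt_eqF// sin_gt0_pi// natdiff_bound.
pose b : R := (k%:R - l%:R) * x.
have n0 : 2 * sin a != 0 by rewrite mulf_neq0// pnatr_eq0.
apply: (mulfI n0); rewrite mulr0 mulr_sumr.
pose F j : R := sin (b + a - 2 * a * j%:R).
have tele j : 2 * sin a * cos (k%:R * (x - fejer_node N j) - l%:R * (x - fejer_node N j)) =
    - (F j.+1 - F j).
  rewrite /F -[j.+1%:R]natr1.
  have -> : b + a - 2 * a * (j%:R + 1) = (b - 2 * a * j%:R) - a by ring.
  have -> : b + a - 2 * a * j%:R = (b - 2 * a * j%:R) + a by ring.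
  have -> : k%:R * (x - fejer_node N j) - l%:R * (x - fejer_node N j) = b - 2 * a * j%:R.
    by rewrite /b /a /fejer_node; field.
  by move: (b - _) => d; rewrite sinB sinD; ring.
under eq_bigr do rewrite tele.
rewrite sumrN -(big_mkord xpredT (fun j => F j.+1 - F j)) telescope_sumr// /F.
have -> : b + a - 2 * a * N%:R = b + a - (pi *+ 2) *+ (k - l)%N.
  by rewrite /a -(mulr_natr (pi *+ 2)) -(mulr_natr pi) natrB 1?ltnW//; field.
have -> : sin (b + a - (pi *+ 2) *+ (k - l)) = sin (b + a).
  by rewrite -(periodicn (@sinD2pi R) (k - l) (b + a - _)) subrK.
by rewrite mulr0 subr0 subrr oppr0.
Qed.

Lemma sum_cos_nodeE k l N x : (l < N)%N -> (k < N)%N ->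
  \sum_(j < N) cos (k%:R * (x - fejer_node N j) - l%:R * (x - fejer_node N j)) =
  N%:R * (k == l)%:R.
Proof.
move=> lN kN; case: (ltngtP k l) => [kl|lk|->]; rewrite ?mulr0 ?mulr1.
- under eq_bigr do rewrite -cosN opprB.
  exact: sum_cos_node.
- exact: sum_cos_node.
- under eq_bigr do rewrite subrr cos0.
  by rewrite sumr_const card_ord.
Qed.

(** Orthogonality at the nodes leaves only the $m$ diagonal pairs $k=l$, each contributing $m+1$.
    The shifted kernels thus average to exactly 1 at every [x]. *)
Lemma sum_fejer m x : (0 < m)%N ->
  \sum_(j < m.+1) fejer m (x - fejer_node m.+1 j) = m.+1%:R.
Proof.
move=> m0; under eq_bigr do rewrite fejerE.
rewrite -mulr_sumr exchange_big /=.
under eq_bigr => k _.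
  rewrite exchange_big /=.
  under eq_bigr => l _ do
    rewrite (@sum_cos_nodeE k l) ?(leqW, ltn_ord) 1?ltnW// ?ltnS ?ltn_ord//.
  rewrite -mulr_sumr (bigD1 k)//= eqxx big1 ?addr0 ?mulr1; last first.
    by move=> l; rewrite eq_sym => /negbTE; rewrite -val_eqE /= => ->.
  over.
by rewrite sumr_const card_ord -(mulr_natl m.+1%:R) mulrA mulVf ?mul1r// pnatr_eq0 -lt0n.
Qed.

(** A factor $\cos$ shifts the frequency difference by $\pm1$, so the $2(m-1)$ pairs with $|k-l|=1$
    survive, each with weight $(m+1)/2$. The kernel averages $1-\cos$ to $1/m$, which is the
    concentration needed for a Korovkin argument. *)
Lemma sum_fejer_cos m x : (0 < m)%N ->
  \sum_(j < m.+1) fejer m (x - fejer_node m.+1 j) * (1 - cos (x - fejer_node m.+1 j)) =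
  m.+1%:R / m%:R.
Proof.
move=> m0; under eq_bigr do rewrite mulrBr mulr1.
rewrite sumrB sum_fejer//.
under eq_bigr do rewrite fejerE -mulrA mulr_suml.
rewrite -mulr_sumr exchange_big /=.
have E (k l : 'I_m) : \sum_(i < m.+1)
    cos (k%:R * (x - fejer_node m.+1 i) - l%:R * (x - fejer_node m.+1 i)) *
    cos (x - fejer_node m.+1 i) =
    m.+1%:R / 2 * ((k.+1 == l)%:R + (k == l.+1 :> nat)%:R).
  (* The shifted frequencies [k.+1] and [l.+1] can reach $m$; orthogonality still applies because
     there are $m+1$ nodes, not $m$. *)
  have kl := @sum_cos_nodeE k.+1 l m.+1 x (leqW (ltn_ord l)) (ltn_ord k : (k.+1 < m.+1)%N).
  have lk := @sum_cos_nodeE k l.+1 m.+1 x (ltn_ord l : (l.+1 < m.+1)%N) (leqW (ltn_ord k)).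
  rewrite mulrAC mulrDr -kl -lk -big_split /=.
  rewrite mulr_suml; apply: eq_bigr => i _ /=.
  set y := x - _.
  have -> : k.+1%:R * y - l%:R * y = (k%:R * y - l%:R * y) + y.
    by rewrite -natr1; ring.
  have -> : k%:R * y - l.+1%:R * y = (k%:R * y - l%:R * y) - y.
    by rewrite -[l.+1%:R]natr1; ring.
  by move: (k%:R * y - _) => w; rewrite (cosB w y) (cosD w y); field.
under eq_bigr => k _.
  under eq_bigr do rewrite mulr_suml.
  rewrite exchange_big /=.
  under eq_bigr do rewrite E.
  rewrite -mulr_sumr.
  over.
rewrite -mulr_sumr.
have S1 : \sum_(k < m) \sum_(l < m) (k.+1 == l)%:R = m%:R - 1 :> R.
  (* Sum over [k] first: [l = 0] has no predecessor and every other [l] has exactly one. *)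
  case: m m0 {E x} => // m _; rewrite exchange_big big_ord_recl /=.
  rewrite big1 ?add0r; last by move=> k _.
  under eq_bigr => l _.
    rewrite (bigD1 (widen_ord (leqnSn m) l))//= eqxx big1; last first.
      by move=> k; rewrite -val_eqE /= eqSS => /negbTE ->.
    rewrite addr0.
    over.
  by rewrite sumr_const card_ord -[m.+1%:R]natr1 addrK.
have S2 : \sum_(k < m) \sum_(l < m) (k == l.+1 :> nat)%:R = m%:R - 1 :> R.
  by rewrite exchange_big -S1; apply: eq_bigr => k _; apply: eq_bigr => l _; rewrite eq_sym.
rewrite (eq_bigr (fun k : 'I_m => \sum_(l < m) (k.+1 == l)%:R +
  \sum_(l < m) (k == l.+1 :> nat)%:R)); last by move=> k _; rewrite big_split.
rewrite big_split /= S1 S2.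
have : (m%:R : R) != 0 by rewrite pnatr_eq0 -lt0n.
by move=> ?; field.
Qed.

(** * Trigonometric polynomials, their primitives, and approximation with the derivative *)

Inductive trigpoly : (R -> R) -> Prop :=
| trigpoly_cst a : trigpoly (fun=> a)
| trigpoly_lin a p q : trigpoly p -> trigpoly q ->
    trigpoly (fun t => a * p t + q t)
| trigpoly_cos (d : int) : trigpoly (fun t => cos (d%:~R * t))
| trigpoly_sin (d : int) : trigpoly (fun t => sin (d%:~R * t)).

Lemma periodicz (f : R -> R) (T : R) (n : int) : periodic f T ->
  forall x, f (x + T * n%:~R) = f x.
Proof.
move=> pf x; case: n => n; first by rewrite -pmulrn mulr_natr periodicn.
by rewrite NegzE mulrNz mulrN -pmulrn mulr_natr -[in RHS](subrK (T *+ n.+1) x) periodicn.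
Qed.

Lemma periodic_rep (T x : R) : 0 < T ->
  exists n : int, 0 <= x + T * n%:~R < T.
Proof.
move=> T0; exists (- Num.floor (x / T)).
have /andP[h1 h2] := floor_itv (x / T).
rewrite mulrNz; move: h1 h2; rewrite ler_pdivlMr// ltr_pdivrMr// intrD.
by move=> h1 h2; apply/andP; split; lra.
Qed.

Lemma trigpoly_periodic p : trigpoly p -> periodic p (2 * pi).
Proof.
have E (d : int) t : d%:~R * (t + 2 * pi) = d%:~R * t + (pi *+ 2) * d%:~R :> R.
  by rewrite -(mulr_natr pi); ring.
elim=> [a|a f g _ pf _ pg|d|d] t //=.
- by rewrite pf pg.
- by rewrite E periodicz//; exact: cosD2pi.
- by rewrite E periodicz//; exact: sinD2pi.
Qed.

Lemma is_derive_lin a (p q : R -> R) t dp dq :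
  is_derive t 1 p dp -> is_derive t 1 q dq ->
  is_derive t 1 (fun t => a * p t + q t) (a * dp + dq).
Proof.
move=> hp hq.
exact: (@is_deriveD _ _ _ (a \*: p) q _ _ (a *: dp) dq).
Qed.

Lemma is_derive_cosz (d x t : R) :
  is_derive t 1 (fun t => cos (d * t + x)) (- (d * sin (d * t + x))).
Proof.
have h : is_derive t 1 (fun t => d * t + x) (d * 1 + 0).
  exact: (@is_derive_lin d id (cst x)).
have := @is_derive1_comp R cos (fun t => d * t + x) t _ _ (is_derive_cos _) h.
by rewrite addr0 mulr1 mulNr mulrC.
Qed.

Lemma is_derive_sinz (d x t : R) :
  is_derive t 1 (fun t => sin (d * t + x)) (d * cos (d * t + x)).
Proof.
have h : is_derive t 1 (fun t => d * t + x) (d * 1 + 0).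
  exact: (@is_derive_lin d id (cst x)).
have := @is_derive1_comp R sin (fun t => d * t + x) t _ _ (is_derive_sin _) h.
by rewrite addr0 mulr1 mulrC.
Qed.

(** The constant [c] is the mean of [q]: it has no periodic primitive and must be removed before
    integrating. *)
Definition has_trig_primitive (q : R -> R) :=
  exists p c, trigpoly p /\ forall t, is_derive t 1 p (q t - c).

Lemma has_trig_primitive_lin a q r :
  has_trig_primitive q -> has_trig_primitive r ->
  has_trig_primitive (fun t => a * q t + r t).
Proof.
move=> [p [c [tp dp]]] [p' [c' [tp' dp']]].
exists (fun t => a * p t + p' t), (a * c + c'); split.
  exact: trigpoly_lin.
move=> t; rewrite (_ : _ - _ = a * (q t - c) + (r t - c')); last by ring.
exact: is_derive_lin.
Qed.

Lemma has_trig_primitive0 : has_trig_primitive (fun=> 0).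
Proof.
exists (fun=> 0), 0; split; first exact: trigpoly_cst.
by move=> t; rewrite subr0; exact: is_derive_cst.
Qed.

Lemma has_trig_primitive_sum (I : Type) (s : seq I) (a : I -> R) (q : I -> R -> R) :
  (forall i, has_trig_primitive (q i)) ->
  has_trig_primitive (fun t => \sum_(i <- s) a i * q i t).
Proof.
move=> hq; elim: s => [|i s IH].
  by under eq_fun do rewrite big_nil; exact: has_trig_primitive0.
by under eq_fun do rewrite big_cons; exact: has_trig_primitive_lin.
Qed.

Lemma has_trig_primitive_cos k l y :
  has_trig_primitive (fun t => cos (k%:R * (t - y) - l%:R * (t - y))).
Proof.
pose d : int := k%:Z - l%:Z.
have E t : k%:R * (t - y) - l%:R * (t - y) = d%:~R * t + (- d%:~R * y).
  by rewrite /d rmorphB /= -!pmulrn; ring.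
under eq_fun do rewrite E.
(* At frequency zero the function is the constant 1, which is all mean; otherwise the mean is 0 and
   the primitive is a sine divided by [d]. *)
have [d0|d0] := eqVneq (d%:~R : R) 0.
  exists (fun=> 0), 1; split; first exact: trigpoly_cst.
  move=> t; rewrite d0 !(mul0r, oppr0) add0r cos0 subrr; exact: is_derive_cst.
exists (fun t => d%:~R^-1 * sin (d%:~R * t + (- d%:~R * y)) + 0), 0; split.
  under eq_fun do rewrite sinD mulrDr.
  rewrite (_ : (fun _ => _) = (fun t => d%:~R^-1 * cos (- d%:~R * y) * sin (d%:~R * t) +
    (d%:~R^-1 * sin (- d%:~R * y) * cos (d%:~R * t) + 0))); last first.
    by apply/funext => t; ring.
  apply: trigpoly_lin; first exact: trigpoly_sin.
  by apply: trigpoly_lin; [exact: trigpoly_cos|exact: trigpoly_cst].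
move=> t; rewrite (_ : _ - 0 = d%:~R^-1 * (d%:~R * cos (d%:~R * t + (- d%:~R * y))) + 0).
  apply: is_derive_lin; exact: is_derive_sinz.
by rewrite subr0 addr0 mulKf.
Qed.

Lemma has_trig_primitive_fejer m y :
  has_trig_primitive (fun t => fejer m (t - y)).
Proof.
under eq_fun do rewrite fejerE big_distrr /=.
apply: has_trig_primitive_sum => k.
rewrite (_ : (fun _ => _) = fun t => \sum_(l < m)
    1 * cos (k%:R * (t - y) - l%:R * (t - y))); last first.
  by apply/funext => t; apply: eq_bigr => l _; rewrite mul1r.
by apply: has_trig_primitive_sum => l; exact: has_trig_primitive_cos.
Qed.

(** Korovkin's inequality. Points close modulo $2\pi$ are handled by uniform continuity; for the
    others $1-\cos(x-y)$ is bounded below, so a large [C] absorbs the sup bound of [g]. *)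
Lemma periodic_unif (g : R -> R) : continuous g -> periodic g (2 * pi) ->
  forall e, 0 < e -> exists2 C : R, 0 <= C &
    forall x y, `|g x - g y| <= e + C * (1 - cos (x - y)).
Proof.
move=> cg pg e e0; have p0 := pi_gt0 R.
have [M Mg] : exists M, forall x, `|g x| <= M.
  have [||c _ Mc] := @EVT_max _ (fun x => `|g x|) 0 (2 * pi); first by lra.
    apply: continuous_subspaceT => x; apply: continuous_comp; first exact: cg.
    exact: norm_continuous.
  exists `|g c| => x.
  have [|n /andP[n0 nT]] := @periodic_rep (2 * pi) x; first by lra.
  by rewrite -(periodicz _ _ n pg) Mc// in_itv /= n0 ltW.
have M0 : 0 <= M by rewrite (le_trans _ (Mg 0)).
(* Compactness of one period gives a uniform [d]. Only [x] is confined to the period, since [y] will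
   be moved next to [x] and may leave it. *)
have [d [d0 dpi] ud] : exists2 d, 0 < d /\ d < pi & forall x y, 0 <= x <= 2 * pi ->
    `|x - y| < d -> `|g x - g y| <= e.
  have /compact_near_coveringP K := @segment_compact R 0 (2 * pi).
  have nd : \forall d \near (0 : R)^'+, `[0, 2 * pi] `<=`
      [set x | forall y, `|x - y| < d -> `|g x - g y| <= e].
    apply: K => x _.
    have /cvgrPdist_le/(_ (e / 2)) := cg x.
    move=> /(_ _)/nbhs_ballP[|r /= r0 rg]; first by rewrite divr_gt0.
    exists (ball x (r / 2), [set d | d < r / 2]) => /=; first split.
    - by apply: nbhsx_ballx; rewrite divr_gt0.
    - by apply: nbhs_right_lt; rewrite divr_gt0.
    move=> [x' d] /= [xx' dr] y xy.
    rewrite -[g x' - g y](subrKA (g x)) (le_trans (ler_normD _ _))//.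
    rewrite [e]splitr lerD//; first rewrite distrC; apply: rg; rewrite /ball /=.
      by rewrite (lt_le_trans xx')// ler_pdivrMr// ler_pMr// ler1n.
    rewrite -[x - y](subrKA x') (le_lt_trans (ler_normD _ _))//.
    by rewrite [r]splitr ltrD// (lt_trans xy).
  near (0 : R)^'+ => d; exists d.
    by split; near: d; [exact: nbhs_right_gt|exact: nbhs_right_lt].
  move=> x y xT; have : (`[0, 2 * pi] `<=`
      [set x | forall y, `|x - y| < d -> `|g x - g y| <= e]) by near: d.
  by apply; rewrite /= in_itv.
have cd : cos d < 1 by rewrite -cos0 ltr_cos ?in_itv /= ?lexx ?ltW//; apply/andP; split; lra.
(* Chosen so that at distance at least [d] the second term alone exceeds $2M$, the trivial bound on
   the difference. *)
exists (2 * M / (1 - cos d)); first by rewrite divr_ge0 ?mulr_ge0// subr_ge0 ltW.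
move=> x y.
have [|n /andP[n0 nT]] := @periodic_rep (2 * pi) x; first by lra.
(* The shift by [pi] brings [y] within [pi] of the translated [x], the range where cosine decreases
   with the distance. *)
have [|k /andP[k0 kT]] := @periodic_rep (2 * pi) (y - (x + 2 * pi * n%:~R) + pi); first by lra.
pose x' := x + 2 * pi * n%:~R; pose y' := y + 2 * pi * k%:~R.
have -> : g x = g x' by rewrite periodicz.
have -> : g y = g y' by rewrite periodicz.
have -> : cos (x - y) = cos `|x' - y'|.
  rewrite cos_norm (_ : x' - y' = x - y + (pi *+ 2) * (n - k)%:~R).
    by rewrite periodicz//; exact: cosD2pi.
  by rewrite /x' /y' intrB -(mulr_natr pi); ring.
have xy : `|x' - y'| <= pi by rewrite ler_norml /x' /y'; apply/andP; split; lra.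
have D0 : 0 <= 2 * M / (1 - cos d) by rewrite divr_ge0 ?mulr_ge0// subr_ge0 ltW.
have [xyd|xyd] := ltP `|x' - y'| d.
  apply: (le_trans (ud _ _ _ xyd)); first by rewrite /x' n0 ltW.
  by rewrite lerDl mulr_ge0// subr_ge0 cos_le1.
have h : cos `|x' - y'| <= cos d.
  have [->//|neq] := eqVneq `|x' - y'| d.
  have dy : d < `|x' - y'| by rewrite lt_def neq.
  by rewrite ltW// ltr_cos// in_itv /= ?normr_ge0// ltW//= ltW.
apply: (@le_trans _ _ (2 * M)).
  by rewrite (le_trans (ler_normB _ _))// mulr2n mulrDl mul1r lerD.
rewrite (@le_trans _ _ (2 * M / (1 - cos d) * (1 - cos d)))//.
  by rewrite divfK// subr_eq0 gt_eqF.
rewrite (@le_trans _ _ (2 * M / (1 - cos d) * (1 - cos `|x' - y'|)))//.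
  by rewrite ler_wpM2l// lerD2l lerN2.
by rewrite lerDr ltW.
Unshelve. all: by end_near. Qed.

Lemma derive1_periodic (u : R -> R) (T : R) : (forall t, derivable u t 1) ->
  periodic u T -> periodic (u^`() : R -> R) T.
Proof.
move=> du pu t.
have h : is_derive t 1 (fun t => 1 * t + T) (1 * 1 + 0).
  exact: (@is_derive_lin 1 id (cst T)).
have hu : is_derive (1 * t + T) 1 u ('D_1 u (1 * t + T)) by exact: derivableP.
have := @is_derive1_comp R u (fun t => 1 * t + T) t _ _ hu h.
rewrite (_ : u \o _ = u); last by apply/funext => s /=; rewrite mul1r pu.
by rewrite !mul1r addr0 mulr1 => H; rewrite !derive1E (@derive_val _ _ _ _ _ _ _ H).
Qed.

(** The derivative is approximated uniformly by a discrete Fejer sum [q], whose primitive [p] exists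
    after removing the mean [c]. Both the error of [q] and [c] itself cost at most $e/2$. *)
Lemma trig_approx (u : R -> R) e : 0 < e -> (forall t, derivable u t 1) ->
  continuous (u^`() : R -> R) -> periodic u (2 * pi) ->
  exists p, [/\ trigpoly p, p 0 = u 0 &
    forall t, exists2 d, is_derive t 1 (fun t => u t - p t) d & `|d| <= e].
Proof.
move=> e0 du cu pu; set g := u^`(); have p0 := pi_gt0 R.
have pg : periodic g (2 * pi) by exact: derive1_periodic.
have e4 : 0 < e / 4 by rewrite divr_gt0.
have [C C0 HC] := @periodic_unif g cu pg _ e4.
have [m m0 Cm] : exists2 m, (0 < m)%N & C / m%:R <= e / 4.
  exists (Num.truncn (C / (e / 4))).+1 => //.
  rewrite ler_pdivrMr ?ltr0n// mulrC -ler_pdivrMr//.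
  by rewrite ltW// truncnS_gt.
have N0 : (0 : R) < m.+1%:R by rewrite ltr0n.
have m1 : (0 : R) < m%:R by rewrite ltr0n.
pose q t := \sum_(j < m.+1)
  (m.+1%:R^-1 * g (fejer_node m.+1 j)) * fejer m (t - fejer_node m.+1 j).
(* By [sum_fejer] the difference is an average of [g t] minus the node values; [periodic_unif] and
   [sum_fejer_cos] bound it by $e/4+C/m$. *)
have qg t : `|g t - q t| <= e / 2.
  have -> : g t - q t = \sum_(j < m.+1)
      m.+1%:R^-1 * ((g t - g (fejer_node m.+1 j)) * fejer m (t - fejer_node m.+1 j)).
    rewrite /q -{1}(mulr1 (g t)) -[X in g t * X](divff (lt0r_neq0 N0)).
    rewrite -{1}(@sum_fejer m t)// mulrA mulr_sumr mulr_suml -sumrB.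
    by apply: eq_bigr => j _; ring.
  apply: (le_trans (ler_norm_sum _ _ _)).
  apply: (@le_trans _ _ (\sum_(j < m.+1) m.+1%:R^-1 *
    (e / 4 * fejer m (t - fejer_node m.+1 j) +
     C * (fejer m (t - fejer_node m.+1 j) * (1 - cos (t - fejer_node m.+1 j)))))).
    apply: ler_sum => j _; rewrite normrM ger0_norm ?invr_ge0 ?ler0n//.
    rewrite ler_wpM2l ?invr_ge0 ?ler0n// normrM (ger0_norm (fejer_ge0 _ _)).
    rewrite [leRHS](_ : _ = (e / 4 + C * (1 - cos (t - fejer_node m.+1 j))) *
      fejer m (t - fejer_node m.+1 j)); last by ring.
    by rewrite ler_wpM2r ?fejer_ge0.
  rewrite -mulr_sumr big_split /= -(mulr_sumr _ _ _ (e / 4)) -(mulr_sumr _ _ _ C).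
  rewrite sum_fejer// sum_fejer_cos//.
  have -> : m.+1%:R^-1 * (e / 4 * m.+1%:R + C * (m.+1%:R / m%:R)) = e / 4 + C / m%:R.
    by field; rewrite !lt0r_neq0.
  by lra.
have [p [c [tp dp]]] : has_trig_primitive q.
  by apply: has_trig_primitive_sum => j; exact: has_trig_primitive_fejer.
have dup t : is_derive t 1 (fun t => u t - p t) (g t - (q t - c)).
  have hu : is_derive t 1 u (g t) by rewrite /g derive1E; exact: derivableP.
  exact: (@is_deriveB _ _ _ u p t 1 (g t) (q t - c)).
(* As [u - p] is periodic, its derivative $g-q+c$ vanishes somewhere; there $|c|=|g-q|$. *)
have cb : `|c| <= e / 2.
  have [||x _] := @MVT_segment R (fun t => u t - p t) (fun t => g t - (q t - c)) 0 (2 * pi).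
  - by lra.
  - apply: derivable_within_continuous => x _.
    exact: ex_derive.
  rewrite -{1}(add0r (2 * pi)) pu -{1}(add0r (2 * pi)) trigpoly_periodic//.
  rewrite subrr subr0 => /esym/eqP.
  rewrite mulf_eq0 orbC gt_eqF ?mulr_gt0//= opprB addrCA addrC => /eqP h.
  have -> : c = - (g x - q x) by lra.
  by rewrite normrN.
(* Matching the values at 0 lets a bound on the derivative control the difference itself later
   on. *)
exists (fun t => 1 * p t + (u 0 - p 0)); split.
- by apply: trigpoly_lin => //; exact: trigpoly_cst.
- by rewrite mul1r addrC subrK.
- move=> t; exists (g t - (q t - c)); last first.
    by rewrite opprB addrCA addrC (le_trans (ler_normD _ _))// [e]splitr lerD.
  rewrite (_ : (fun _ => _) = (fun t => 1 * (u t - p t) + (p 0 - u 0))); last first.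
    by apply/funext => s; ring.
  rewrite -[X in is_derive _ _ _ X]addr0 -[X in is_derive _ _ _ (X + _)]mul1r.
  by apply: is_derive_lin; exact: dup.
Qed.

(** * From bounds on the derivative to Lipschitz bounds in the chord *)

Lemma lipschitz_of_derive (h : R -> R) e :
  (forall t, exists2 d, is_derive t 1 h d & `|d| <= e) ->
  forall s t, `|h s - h t| <= e * `|s - t|.
Proof.
move=> dh; have [d dhd db] : exists2 d : R -> R, (forall t, is_derive t 1 h (d t)) &
    forall t, `|d t| <= e.
  have /choice[d hd] : forall t, exists d, is_derive t 1 h d /\ `|d| <= e.
    by move=> t; have [d ? ?] := dh t; exists d.
  by exists d => t; have [] := hd t.
suff H s t : s <= t -> `|h s - h t| <= e * `|s - t|.
  move=> s t; have [st|/ltW ts] := leP s t; first exact: H.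
  by rewrite distrC [`|s - t|]distrC H.
move=> st; rewrite distrC [`|s - t|]distrC.
have [|x _ ->] := @MVT_segment R h d s t st.
  by apply: derivable_within_continuous => x _; exact: ex_derive.
by rewrite normrM ler_wpM2r.
Qed.

(* [sin y = 2 cos (y / 2) sin (y / 2) >= y cos^2 (y / 2) = y (1 + cos y) / 2] *)
Lemma sin_ge_half y : 0 <= y <= pi / 2 -> y / 2 <= sin y.
Proof.
move=> /andP[y0 yp]; have p0 := pi_gt0 R.
have cy : 0 <= cos y by apply: cos_ge0_pihalf; apply/andP; split; lra.
have [||c] := @MVT_segment R sin cos 0 (y / 2).
- by lra.
- by apply: continuous_subspaceT => x; exact: continuous_sin.
rewrite in_itv /= => /andP[c0 cy2]; rewrite sin0 !subr0 => sE.
have cc : cos (y / 2) <= cos c.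
  have [->//|nc] := eqVneq c (y / 2).
  rewrite ltW// ltr_cos ?in_itv /= ?lt_neqAle ?nc//; apply/andP; split; lra.
have c2 : 0 <= cos (y / 2) by apply: cos_ge0_pihalf; apply/andP; split; lra.
have yE : y = (y / 2) *+ 2 by rewrite -mulr_natr divfK// pnatr_eq0.
have sy : sin y = (cos (y / 2) * sin (y / 2)) *+ 2 by rewrite {1}yE sin_mulr2n.
have cyE : cos y = cos (y / 2) ^+ 2 *+ 2 - 1 by rewrite {1}yE cos_mulr2n.
have h : cos (y / 2) * cos (y / 2) * (y / 2) <= cos (y / 2) * sin (y / 2).
  by rewrite sE -mulrA ler_wpM2l// ler_wpM2r// divr_ge0.
rewrite sy; have cy1 : 1 <= cos (y / 2) ^+ 2 *+ 2 by rewrite -subr_ge0 -cyE.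
have z0 : 0 <= y / 2 by rewrite divr_ge0.
have : y / 2 * 1 <= y / 2 * (cos (y / 2) ^+ 2 *+ 2) by rewrite ler_wpM2l.
by rewrite expr2; move: h; move: (cos (y / 2)) (sin (y / 2)) => a b; lra.
Qed.

(** The squared chord is $4\sin^2(x/2)$, and [sin_ge_half] at $|x|/2\le\pi/2$ bounds the sine below
    by $|x|/4$. *)
Lemma chord_ge x : `|x| <= pi -> x ^+ 2 / 4 <= 2 - 2 * cos x.
Proof.
move=> xp; rewrite -(cos_norm x) -[x ^+ 2]real_normK ?num_real//.
move: `|x| (normr_ge0 x) xp => {}x x0 xp.
have h := @sin_ge_half (x / 2) _.
have {}h : x / 2 / 2 <= sin (x / 2) by apply: h; apply/andP; split; lra.
have xE : x = (x / 2) *+ 2 by rewrite -mulr_natr divfK// pnatr_eq0.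
have -> : cos x = 1 - 2 * sin (x / 2) ^+ 2.
  by rewrite {1}xE cos_mulr2n cos2sin2 mulr2n; ring.
have : (x / 2 / 2) ^+ 2 <= sin (x / 2) ^+ 2.
  by rewrite ler_sqr ?nnegrE ?divr_ge0// (le_trans _ h)// !divr_ge0.
rewrite !expr2; lra.
Qed.

(** Periodicity moves [t] within [pi] of [s]; there the arc is at most twice the chord, whence the
    factor 4. *)
Lemma chord_lipschitz (h : R -> R) e : 0 <= e ->
  (forall t, exists2 d, is_derive t 1 h d & `|d| <= e) -> periodic h (2 * pi) ->
  forall s t, (h s - h t) ^+ 2 <= 4 * e ^+ 2 * (2 - 2 * cos (t - s)).
Proof.
move=> e0 dh ph s t; have p0 := pi_gt0 R.
have [|n /andP[n0 nT]] := @periodic_rep (2 * pi) (t - s + pi); first by lra.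
pose t' := t + 2 * pi * n%:~R.
rewrite -(periodicz _ _ n ph t) -/t'.
have -> : cos (t - s) = cos (t' - s).
  rewrite (_ : t' - s = t - s + (pi *+ 2) * n%:~R); last first.
    by rewrite /t' -(mulr_natr pi); ring.
  by rewrite periodicz//; exact: cosD2pi.
have ts : `|t' - s| <= pi by rewrite ler_norml /t'; apply/andP; split; lra.
have := chord_ge _ ts.
have := @lipschitz_of_derive _ _ dh s t'.
move=> hl hc; rewrite -real_normK ?num_real//.
apply: (@le_trans _ _ ((e * `|s - t'|) ^+ 2)).
  by rewrite ler_sqr ?nnegrE ?mulr_ge0.
rewrite exprMn distrC real_normK ?num_real// mulrC -mulrA mulrCA.
have := sqr_ge0 e; nra.
Qed.

End Fejer.

(** * Real and imaginary parts, and the squared modulus *)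

Section ComplexParts.
Variable R : realType.
Implicit Types x y z : R[i].

Lemma cReD x y : cRe (x + y) = cRe x + cRe y. Proof. by case: x y => ? ? []. Qed.
Lemma cImD x y : cIm (x + y) = cIm x + cIm y. Proof. by case: x y => ? ? []. Qed.
Lemma cReN x : cRe (- x) = - cRe x. Proof. by case: x. Qed.
Lemma cImN x : cIm (- x) = - cIm x. Proof. by case: x. Qed.
Lemma cReM x y : cRe (x * y) = cRe x * cRe y - cIm x * cIm y.
Proof. by case: x y => ? ? []. Qed.
Lemma cImM x y : cIm (x * y) = cRe x * cIm y + cIm x * cRe y.
Proof. by case: x y => ? ? []. Qed.
Lemma cReJ x : cRe x^* = cRe x. Proof. by case: x. Qed.
Lemma cImJ x : cIm x^* = - cIm x. Proof. by case: x. Qed.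
Lemma cReV x : cRe x^-1 = cRe x * (sqn x)^-1. Proof. by case: x. Qed.
Lemma cImV x : cIm x^-1 = - (cIm x * (sqn x)^-1). Proof. by case: x. Qed.
Lemma complex_ext x y : cRe x = cRe y -> cIm x = cIm y -> x = y.
Proof. by case: x y => a b [c d] /= -> ->. Qed.

Definition cReImE := (cReD, cImD, cReN, cImN, cReM, cImM, cReJ, cImJ).

Lemma sqnM x y : sqn (x * y) = sqn x * sqn y.
Proof. by rewrite /sqn !cReImE; ring. Qed.
Lemma sqnJ x : sqn x^* = sqn x.
Proof. by rewrite /sqn !cReImE; ring. Qed.
Lemma sqnN x : sqn (- x) = sqn x.
Proof. by rewrite /sqn !cReImE; ring. Qed.
Lemma sqn_ge0 x : 0 <= sqn x.
Proof. by rewrite addr_ge0 ?sqr_ge0. Qed.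
Lemma sqnD_le x y : sqn (x + y) <= 2 * sqn x + 2 * sqn y.
Proof.
rewrite /sqn !cReImE.
have := sqr_ge0 (cRe x - cRe y); have := sqr_ge0 (cIm x - cIm y).
rewrite !expr2; lra.
Qed.
Lemma sqn_expi t : sqn (expi t : R[i]) = 1.
Proof. exact: cos2Dsin2. Qed.
Lemma sqn_eq0 x : sqn x = 0 -> x = 0.
Proof.
move/eqP; rewrite paddr_eq0 ?sqr_ge0// !sqrf_eq0 => /andP[/eqP h1 /eqP h2].
exact: complex_ext.
Qed.
Lemma sqn0 : sqn (0 : R[i]) = 0. Proof. by rewrite /sqn /= expr0n addr0. Qed.
Lemma sqn1 : sqn (1 : R[i]) = 1. Proof. by rewrite /sqn /= expr0n addr0 expr1n. Qed.
Lemma normr_cRe_le x : `|cRe x| <= 1 + sqn x.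
Proof.
rewrite ler_norml /sqn; have := sqr_ge0 (cIm x).
have := sqr_ge0 (cRe x - 1); have := sqr_ge0 (cRe x + 1).
by rewrite !expr2 => ? ? ?; apply/andP; split; nra.
Qed.
Lemma normr_cIm_le x : `|cIm x| <= 1 + sqn x.
Proof.
rewrite ler_norml /sqn; have := sqr_ge0 (cRe x).
have := sqr_ge0 (cIm x - 1); have := sqr_ge0 (cIm x + 1).
by rewrite !expr2 => ? ? ?; apply/andP; split; nra.
Qed.

Lemma expi_neq0 t : expi t != 0 :> R[i].
Proof.
by apply/eqP => h; have := sqn_expi t; rewrite h sqn0 => /esym/eqP; rewrite oner_eq0.
Qed.
Lemma expiM (t : R) : (expi t)^* * expi t = 1 :> R[i].
Proof.
apply: complex_ext; rewrite !cReImE /=; last by ring.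
by rewrite -[RHS](cos2Dsin2 t); ring.
Qed.
Lemma sqn_chord (s t : R) : sqn (1 - (expi s)^* * expi t) = 2 - 2 * cos (t - s).
Proof.
rewrite /sqn !cReImE /= cosB.
have h1 := cos2Dsin2 t; have h2 := cos2Dsin2 s.
transitivity (1 - 2 * (cos t * cos s + sin t * sin s) +
   (cos t ^+ 2 + sin t ^+ 2) * (cos s ^+ 2 + sin s ^+ 2)); first by ring.
by rewrite h1 h2; ring.
Qed.
End ComplexParts.

(** * Measurability of complex functions on the circle *)

Section Measurable.
Variable R : realType.
Implicit Types f g : R -> R[i].

Lemma measurable_circ : measurable (@circ R).
Proof. exact: measurable_itv. Qed.

Definition cmeasurable f :=
  measurable_fun (@circ R) (@cRe R \o f : measurableTypeR R -> R) /\
  measurable_fun (@circ R) (@cIm R \o f : measurableTypeR R -> R).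

Lemma cmeasurable_cst a : cmeasurable (fun=> a).
Proof. by split; exact: measurable_cst. Qed.

Lemma cmeasurableD f g : cmeasurable f -> cmeasurable g ->
  cmeasurable (fun t => f t + g t).
Proof.
move=> [f1 f2] [g1 g2]; split.
- rewrite (_ : _ \o _ = (@cRe R \o f) \+ (@cRe R \o g)); last first.
    by apply/funext => t /=; rewrite cReD.
  exact: measurable_funD.
- rewrite (_ : _ \o _ = (@cIm R \o f) \+ (@cIm R \o g)); last first.
    by apply/funext => t /=; rewrite cImD.
  exact: measurable_funD.
Qed.

Lemma cmeasurableM f g : cmeasurable f -> cmeasurable g ->
  cmeasurable (fun t => f t * g t).
Proof.
move=> [f1 f2] [g1 g2]; split.
- rewrite (_ : _ \o _ = (fun t => cRe (f t) * cRe (g t) - cIm (f t) * cIm (g t))); last first.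
    by apply/funext => t /=; rewrite cReM.
  by apply: measurable_funB; exact: measurable_funM.
- rewrite (_ : _ \o _ = (fun t => cRe (f t) * cIm (g t) + cIm (f t) * cRe (g t))); last first.
    by apply/funext => t /=; rewrite cImM.
  by apply: measurable_funD; exact: measurable_funM.
Qed.

Lemma cmeasurableB f g : cmeasurable f -> cmeasurable g ->
  cmeasurable (fun t => f t - g t).
Proof.
move=> mf mg; rewrite (_ : (fun _ => _) = (fun t => f t + (-1) * g t)); last first.
  by apply/funext => t; rewrite mulN1r.
by apply: cmeasurableD => //; apply: cmeasurableM => //; exact: cmeasurable_cst.
Qed.

Lemma cmeasurableJ f : cmeasurable f -> cmeasurable (fun t => (f t)^*).
Proof.
move=> [f1 f2]; split.
- by rewrite (_ : _ \o _ = @cRe R \o f)//; apply/funext => t /=; rewrite cReJ.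
- rewrite (_ : _ \o _ = \- (@cIm R \o f)); first exact: measurable_funN.
  by apply/funext => t /=; rewrite cImJ.
Qed.

Lemma measurable_sqn f : cmeasurable f ->
  measurable_fun (@circ R) ((fun t => sqn (f t)) : measurableTypeR R -> R).
Proof.
move=> [f1 f2]; apply: measurable_funD; exact: measurable_funX.
Qed.

Lemma cmeasurableV f : cmeasurable f -> cmeasurable (fun t => (f t)^-1).
Proof.
move=> mf; have [f1 f2] := mf.
have ms : measurable_fun (@circ R) ((fun t => (sqn (f t))^-1) : measurableTypeR R -> R).
  (* Inversion is written as a real power, which is measurable; both sides take the value 0 at 0. *)
  rewrite (_ : (fun _ => _) = (fun t => powR (sqn (f t)) (-1))); last first.
    by apply/funext => t; rewrite powR_inv1// sqn_ge0.
  by apply: (measurableT_comp (@measurable_powR R (-1))); exact: measurable_sqn.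
split.
- rewrite (_ : _ \o _ = (fun t => cRe (f t) * (sqn (f t))^-1)); last first.
    by apply/funext => t /=; rewrite cReV.
  exact: measurable_funM.
- rewrite (_ : _ \o _ = \- (fun t => cIm (f t) * (sqn (f t))^-1)); last first.
    by apply/funext => t /=; rewrite cImV.
  by apply: measurable_funN; exact: measurable_funM.
Qed.

Lemma cmeasurable_continuous f : continuous (@cRe R \o f) -> continuous (@cIm R \o f) ->
  cmeasurable f.
Proof.
by move=> f1 f2; split; apply: measurable_funTS; exact: continuous_measurable_fun.
Qed.

Lemma cmeasurable_expi : cmeasurable (@expi R).
Proof.
by apply: cmeasurable_continuous => t; [exact: continuous_cos|exact: continuous_sin].
Qed.

End Measurable.

Arguments cmeasurable {R} f.

(** * Complex integrals and square integrable functions *)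

Section Integral.
Variable R : realType.
Variable mu : {measure set (measurableTypeR R) -> \bar R}.
Hypothesis muf : (mu (@circ R) < +oo)%E.
Implicit Types f g h : R -> R[i].
Implicit Types u v : R -> R.

Let mcirc := @measurable_circ R.

Definition rintegrable u := mu.-integrable (@circ R) (EFin \o u).

Lemma rintegrableD u v : rintegrable u -> rintegrable v ->
  rintegrable (fun t => u t + v t).
Proof. by move=> iu iv; exact: (integrableD mcirc iu iv). Qed.

Lemma rintegrableZ a u : rintegrable u -> rintegrable (fun t => a * u t).
Proof. by move=> iu; exact: (integrableZl mcirc a iu). Qed.

Lemma rintegrableB u v : rintegrable u -> rintegrable v ->
  rintegrable (fun t => u t - v t).
Proof. by move=> iu iv; exact: (integrableB mcirc iu iv). Qed.

Lemma rintegrable_le u v :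
  measurable_fun (@circ R) (u : measurableTypeR R -> R) ->
  (forall t, circ t -> `|u t| <= v t) -> rintegrable v -> rintegrable u.
Proof.
move=> mu_ uv iv; apply: (le_integrable mcirc _ _ iv).
  exact/measurable_EFinP.
by move=> t ct /=; rewrite lee_fin (le_trans (uv _ ct))// ler_norm.
Qed.

Lemma rintegrable_cst a : rintegrable (fun=> a).
Proof.
apply: (@measurable_bounded_integrable _ _ _ mu (fun=> a) _ mcirc muf) => //.
exists `|a|; split => [|M aM t _ /=]; last exact: ltW.
exact: num_real.
Qed.

Definition cintegrable h := rintegrable (@cRe R \o h) /\ rintegrable (@cIm R \o h).

Lemma cintegrableD f g : cintegrable f -> cintegrable g ->
  cintegrable (fun t => f t + g t).
Proof.
move=> [f1 f2] [g1 g2]; split.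
- rewrite (_ : _ \o _ = (fun t => cRe (f t) + cRe (g t))); first exact: rintegrableD.
  by apply/funext => t /=; rewrite cReD.
- rewrite (_ : _ \o _ = (fun t => cIm (f t) + cIm (g t))); first exact: rintegrableD.
  by apply/funext => t /=; rewrite cImD.
Qed.

Lemma cintegrableZ a f : cintegrable f -> cintegrable (fun t => a * f t).
Proof.
move=> [f1 f2]; split.
- rewrite (_ : _ \o _ = (fun t => cRe a * cRe (f t) - cIm a * cIm (f t))).
    by apply: rintegrableB; exact: rintegrableZ.
  by apply/funext => t /=; rewrite cReM.
- rewrite (_ : _ \o _ = (fun t => cRe a * cIm (f t) + cIm a * cRe (f t))).
    by apply: rintegrableD; exact: rintegrableZ.
  by apply/funext => t /=; rewrite cImM.
Qed.

Lemma cintD f g : cintegrable f -> cintegrable g ->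
  cint mu (fun t => f t + g t) = cint mu f + cint mu g.
Proof.
move=> [f1 f2] [g1 g2]; apply: complex_ext; rewrite ?cReImE /=.
- rewrite -(RintegralD mcirc f1 g1).
  by apply: eq_Rintegral => t _ /=; rewrite cReD.
- rewrite -(RintegralD mcirc f2 g2).
  by apply: eq_Rintegral => t _ /=; rewrite cImD.
Qed.

Lemma cintZ a f : cintegrable f -> cint mu (fun t => a * f t) = a * cint mu f.
Proof.
move=> [f1 f2]; apply: complex_ext; rewrite ?cReImE /=.
- rewrite -!(RintegralZl _ mcirc)//.
  rewrite -(RintegralB mcirc (rintegrableZ _ _ f1) (rintegrableZ _ _ f2)).
  by apply: eq_Rintegral => t _ /=; rewrite cReM.
- rewrite -!(RintegralZl _ mcirc)//.
  rewrite -(RintegralD mcirc (rintegrableZ _ _ f2) (rintegrableZ _ _ f1)).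
  by apply: eq_Rintegral => t _ /=; rewrite cImM.
Qed.

Lemma eq_cint f g : (forall t, circ t -> f t = g t) -> cint mu f = cint mu g.
Proof.
move=> fg; apply: complex_ext => /=; apply: eq_Rintegral => t /set_mem ct /=;
  by rewrite fg.
Qed.

Lemma cintegrable_bounded f K : cmeasurable f ->
  (forall t, circ t -> sqn (f t) <= K) -> cintegrable f.
Proof.
move=> [f1 f2] fK; split; apply: (rintegrable_le _ (fun=> 1 + K)) => //;
  try exact: rintegrable_cst.
- by move=> t ct /=; rewrite (le_trans (normr_cRe_le _ _))// lerD2l fK.
- by move=> t ct /=; rewrite (le_trans (normr_cIm_le _ _))// lerD2l fK.
Qed.

Lemma L2_cmeasurable f : L2 mu f -> cmeasurable f.
Proof. by case=> [? []]. Qed.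

Lemma L2_sqn f : L2 mu f -> rintegrable (fun t => sqn (f t)).
Proof. by case=> [_ []]. Qed.

Lemma L2_intro f : cmeasurable f -> rintegrable (fun t => sqn (f t)) -> L2 mu f.
Proof. by case. Qed.

Lemma L2_bounded f K : cmeasurable f ->
  (forall t, circ t -> sqn (f t) <= K) -> L2 mu f.
Proof.
move=> mf fK; apply: L2_intro => //.
apply: (rintegrable_le _ (fun=> K)); [exact: measurable_sqn| |exact: rintegrable_cst].
by move=> t ct; rewrite ger0_norm ?sqn_ge0// fK.
Qed.

Lemma L2_add f g : L2 mu f -> L2 mu g -> L2 mu (fun t => f t + g t).
Proof.
move=> Lf Lg; have mf := L2_cmeasurable _ Lf; have mg := L2_cmeasurable _ Lg.
have mfg := cmeasurableD _ _ _ mf mg.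
apply: L2_intro => //.
apply: (rintegrable_le _ (fun t => 2 * sqn (f t) + 2 * sqn (g t))).
- exact: measurable_sqn.
- by move=> t _; rewrite ger0_norm ?sqn_ge0 ?sqnD_le.
- by apply: rintegrableD; apply: rintegrableZ; exact: L2_sqn.
Qed.

Lemma L2_mul_bounded f g K : cmeasurable g -> (forall t, circ t -> sqn (g t) <= K) ->
  L2 mu f -> L2 mu (fun t => g t * f t).
Proof.
move=> mg gK Lf; have mf := L2_cmeasurable _ Lf.
have mfg := cmeasurableM _ _ _ mg mf.
apply: L2_intro => //.
apply: (rintegrable_le _ (fun t => K * sqn (f t))).
- exact: measurable_sqn.
- by move=> t ct; rewrite ger0_norm ?sqn_ge0// sqnM ler_wpM2r ?sqn_ge0 ?gK.
- by apply: rintegrableZ; exact: L2_sqn.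
Qed.

Lemma L2_scl a f : L2 mu f -> L2 mu (fun t => a * f t).
Proof.
by move=> Lf; apply: (L2_mul_bounded _ (fun=> a) (sqn a)) => //; exact: cmeasurable_cst.
Qed.

Lemma L2_sub f g : L2 mu f -> L2 mu g -> L2 mu (fun t => f t - g t).
Proof.
move=> Lf Lg; rewrite (_ : (fun _ => _) = (fun t => f t + -1 * g t)).
  by apply: L2_add => //; exact: L2_scl.
by apply/funext => t; rewrite mulN1r.
Qed.

Lemma L2_expi f : L2 mu f -> L2 mu (fun t => expi t * f t).
Proof.
move=> Lf; apply: (L2_mul_bounded _ (@expi R) 1) => //; first exact: cmeasurable_expi.
by move=> t _; rewrite sqn_expi.
Qed.

(** Each part of $f\overline g$ is dominated by $|f|^2+|g|^2$, through squares of sums and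
    differences of the parts. *)
Lemma L2_mul_conj f g : L2 mu f -> L2 mu g -> cintegrable (fun t => f t * (g t)^*).
Proof.
move=> Lf Lg; have mf := L2_cmeasurable _ Lf; have mg := L2_cmeasurable _ Lg.
have [m1 m2] := cmeasurableM _ _ _ mf (cmeasurableJ _ _ mg).
have i : rintegrable (fun t => sqn (f t) + sqn (g t)).
  by apply: rintegrableD; exact: L2_sqn.
split; apply: (rintegrable_le _ _ _ _ i) => // t _ /=;
  rewrite ler_norml /sqn !cReImE !expr2; apply/andP.
- have := sqr_ge0 (cRe (f t) - cRe (g t)); have := sqr_ge0 (cRe (f t) + cRe (g t)).
  have := sqr_ge0 (cIm (f t) - cIm (g t)); have := sqr_ge0 (cIm (f t) + cIm (g t)).
  have := sqn_ge0 _ (f t); have := sqn_ge0 _ (g t).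
  by rewrite /sqn !expr2; split; nra.
- have := sqr_ge0 (cRe (f t) - cIm (g t)); have := sqr_ge0 (cRe (f t) + cIm (g t)).
  have := sqr_ge0 (cIm (f t) - cRe (g t)); have := sqr_ge0 (cIm (f t) + cRe (g t)).
  have := sqn_ge0 _ (f t); have := sqn_ge0 _ (g t).
  by rewrite /sqn !expr2; split; nra.
Qed.

Definition sqnorm f : R := Rintegral mu (@circ R) (fun t => sqn (f t)).

Lemma mul_conj_sqn (z : R[i]) : z * z^* = Complex (sqn z) 0.
Proof. by apply: complex_ext; rewrite /sqn !cReImE /=; ring. Qed.

Lemma cint_mul_conj f : cint mu (fun t => f t * (f t)^*) = Complex (sqnorm f) 0.
Proof.
rewrite /cint; congr Complex.
  by apply: eq_Rintegral => t _ /=; rewrite mul_conj_sqn.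
transitivity (\int[mu]_(t in @circ R) (0 : R)).
  by apply: eq_Rintegral => t _ /=; rewrite mul_conj_sqn.
by rewrite (Rintegral_cst _ mcirc) mul0r.
Qed.

Lemma sqnorm_ge0 f : 0 <= sqnorm f.
Proof. by apply: Rintegral_ge0 => t _; exact: sqn_ge0. Qed.

(** Expansion of $|(f-g)+g|^2$; once the cross term vanishes it becomes Pythagoras. *)
Lemma sqnorm_split f g : L2 mu f -> L2 mu g ->
  sqnorm f = sqnorm (fun t => f t - g t) +
    2 * cRe (cint mu (fun t => (f t - g t) * (g t)^*)) + sqnorm g.
Proof.
move=> Lf Lg; have Lfg := L2_sub _ _ Lf Lg.
have [i1 _] := L2_mul_conj _ _ Lfg Lg.
rewrite /sqnorm /= -(RintegralZl _ mcirc)//.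
rewrite -(RintegralD mcirc)//; last 2 first.
- exact: L2_sqn.
- exact: rintegrableZ.
rewrite -(RintegralD mcirc)//; last 2 first.
- by apply: rintegrableD; [exact: L2_sqn|exact: rintegrableZ].
- exact: L2_sqn.
by apply: eq_Rintegral => t _ /=; rewrite /sqn !cReImE; ring.
Qed.

Lemma sqnorm_eq0 f : L2 mu f -> sqnorm f = 0 ->
  {ae mu, forall t, circ t -> f t = 0}.
Proof.
move=> Lf f0; have i := L2_sqn _ Lf.
have : (\int[mu]_(t in @circ R) `|(sqn (f t))%:E| = 0)%E.
  transitivity (\int[mu]_(t in @circ R) (EFin \o (fun t => sqn (f t))) t)%E.
    by apply: eq_integral => t _ /=; rewrite ger0_norm ?sqn_ge0.
  by rewrite -(fineK (integrable_fin_num mcirc i)); congr EFin.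
move/(ae_eq_integral_abs _ mcirc (measurable_int _ i)).
apply: filterS => t h ct.
by have /eqP := h ct; rewrite eqe => /eqP /sqn_eq0.
Qed.

End Integral.

(** * A criterion for almost everywhere nonpositivity *)

Section Dominated.
Variable R : realType.
Let mcirc := @measurable_circ R.

(* [G] is not assumed measurable: this spares the measurability of [t |-> Jint mu f t]. *)
Lemma ae_le0_of_small_dominated (mu : {measure set (measurableTypeR R) -> \bar R})
    (G : R -> R) :
  (forall e, 0 < e -> exists Y : R -> R, [/\ rintegrable R mu Y,
     forall t, 0 <= Y t, {ae mu, forall t, circ t -> G t <= Y t} &
     Rintegral mu (@circ R) Y <= e]) ->
  {ae mu, forall t, circ t -> G t <= 0}.
Proof.
move=> H.
have /choice[Y HY] : forall n : nat, exists Y : R -> R, [/\ rintegrable R mu Y,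
     forall t, 0 <= Y t, {ae mu, forall t, circ t -> G t <= Y t} &
     Rintegral mu (@circ R) Y <= n.+1%:R^-1].
  by move=> n; apply: H; rewrite invr_gt0 ltr0n.
(* The infimum of the dominating functions is measurable with integral zero, so it vanishes almost
   everywhere, and it still dominates [G]. *)
pose Z t := einfs (fun n => (Y n t)%:E) 0.
have ZY n t : (Z t <= (Y n t)%:E)%E.
  by apply: ereal_inf_lbound; exists n.
have Z0 t : (0 <= Z t)%E.
  by apply: le_ereal_inf_tmp => _ [n _ <-]; rewrite lee_fin; have [] := HY n.
have mY n : measurable_fun (@circ R) (fun t : measurableTypeR R => (Y n t)%:E).
  by have [i _ _ _] := HY n; exact: measurable_int i.
have mZ : measurable_fun (@circ R) (Z : measurableTypeR R -> \bar R).
  exact: (@measurable_fun_einfs _ _ _ (@circ R) (fun n t => (Y n t)%:E) mY 0).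
have iZ : (\int[mu]_(t in @circ R) `|Z t| = 0)%E.
  apply/eqP; rewrite eq_le integral_ge0 ?andbT//.
  apply/lee_addgt0Pr => e e0; rewrite add0e.
  pose n := Num.truncn e^-1.
  have ne : n.+1%:R^-1 <= e.
    by rewrite invf_ple ?posrE ?ltr0n// ltW// truncnS_gt.
  have [i Yn0 _ In] := HY n.
  apply: (@le_trans _ _ (\int[mu]_(t in @circ R) (Y n t)%:E)%E).
    apply: ge0_le_integral => //.
    - exact: measurableT_comp.
    - by move=> t _; rewrite gee0_abs.
  have := integrable_fin_num mcirc i => /fineK <-.
  by rewrite lee_fin (le_trans In).
have {}iZ := (ae_eq_integral_abs _ mcirc mZ).1 iZ.
have hG : {ae mu, forall t, forall n, circ t -> G t <= Y n t}.
  by apply: ae_foralln => n; have [] := HY n.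
apply: filterS2 iZ hG => t hZ hG ct.
rewrite -lee_fin; have <- : Z t = 0%:E := hZ ct; apply: le_ereal_inf_tmp => _ [n _ <-].
by rewrite lee_fin hG.
Qed.

End Dominated.

(** * Pairs of functions and compressed multiplication by $z$ *)

Section ModelSpace.
Variable R : realType.
Implicit Types (x y p g : V2 R) (b : bool).

(** A boolean index lets both coordinates be treated by a single argument. *)
Definition component b x : R -> R[i] := if b then x.1 else x.2.

Lemma comp_add2 b x y t : component b (add2 x y) t = component b x t + component b y t.
Proof. by case: b. Qed.
Lemma comp_scl2 b a x t : component b (scl2 a x) t = a * component b x t.
Proof. by case: b. Qed.
Lemma comp_zmul b x t : component b (zmul x) t = expi t * component b x t.
Proof. by case: b. Qed.

Definition L2pair x := forall b, L2 (@lebm R) (component b x).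

Lemma L2pair_sub x y : L2pair x -> L2pair y ->
  L2pair (vsub (@add2 R) (@scl2 R) x y).
Proof.
move=> Lx Ly b; rewrite (_ : component b _ = (fun t => component b x t - component b y t)).
  exact: L2_sub.
by apply/funext => t; rewrite comp_add2 comp_scl2 mulN1r.
Qed.

Lemma L2pair_zmul x : L2pair x -> L2pair (zmul x).
Proof.
move=> Lx b; rewrite (_ : component b _ = (fun t => expi t * component b x t)).
  exact: L2_expi.
by apply/funext => t; rewrite comp_zmul.
Qed.

Lemma nrm2_ip2 x :
  nrm2 (@ip2 R) x =
  (2 * pi)^-1 *
    (sqnorm R (@lebm R) (component true x) +
     sqnorm R (@lebm R) (component false x)).
Proof. by rewrite /nrm2 /ip2 /ipm /cintm !cint_mul_conj// !cReImE /=; ring. Qed.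

Lemma sqnorm_le_nrm2 b x : sqnorm R (@lebm R) (component b x) <= 2 * pi * nrm2 (@ip2 R) x.
Proof.
have p0 := pi_gt0 R; have h1 := sqnorm_ge0 R (@lebm R) (component true x).
have h2 := sqnorm_ge0 R (@lebm R) (component false x).
rewrite nrm2_ip2 mulVKf; last by rewrite gt_eqF// mulr_gt0.
by case: b; rewrite ?lerDl ?lerDr.
Qed.

Lemma nrm2_eq0_ae x : L2pair x -> nrm2 (@ip2 R) x = 0 ->
  {ae @lebm R, forall t, circ t -> forall b, component b x t = 0}.
Proof.
move=> Lx x0.
have H b : {ae @lebm R, forall t, circ t -> component b x t = 0}.
  apply: sqnorm_eq0 => //.
  apply/eqP; rewrite eq_le sqnorm_ge0 andbT.
  by rewrite (le_trans (sqnorm_le_nrm2 b x))// x0 mulr0.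
by apply: filterS2 (H true) (H false) => t h1 h2 ct []; [exact: h1|exact: h2].
Qed.

Lemma eqv_ae x y : L2pair x -> L2pair y ->
  eqv (@add2 R) (@scl2 R) (@ip2 R) x y ->
  {ae @lebm R, forall t, circ t -> forall b, component b x t = component b y t}.
Proof.
move=> Lx Ly /(nrm2_eq0_ae _ (L2pair_sub _ _ Lx Ly)).
apply: filterS => t h ct b; have := h ct b.
by rewrite comp_add2 comp_scl2 mulN1r => /eqP; rewrite subr_eq0 => /eqP.
Qed.

Lemma nrm2_zmul x : nrm2 (@ip2 R) (zmul x) = nrm2 (@ip2 R) x.
Proof.
rewrite !nrm2_ip2; congr (_ * (_ + _)); apply: eq_Rintegral => t _;
  by rewrite comp_zmul sqnM sqn_expi mul1r.
Qed.

Lemma cRe_ip2 x y : cRe (ip2 x y) = (2 * pi)^-1 *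
  (cRe (cint (@lebm R) (fun t => component true x t * (component true y t)^*)) +
   cRe (cint (@lebm R) (fun t => component false x t * (component false y t)^*))).
Proof. by rewrite /ip2 /ipm /cintm cReD !cReM; rewrite !mul0r !subr0 -mulrDr. Qed.

Lemma nrm2_split x p : L2pair x -> L2pair p ->
  ip2 (vsub (@add2 R) (@scl2 R) x p) p = 0 ->
  nrm2 (@ip2 R) x = nrm2 (@ip2 R) (vsub (@add2 R) (@scl2 R) x p) + nrm2 (@ip2 R) p.
Proof.
move=> Lx Lp h.
have E b : component b (vsub (@add2 R) (@scl2 R) x p) =
    (fun t => component b x t - component b p t).
  by apply/funext => t; rewrite comp_add2 comp_scl2 mulN1r.
have : cRe (ip2 (vsub (@add2 R) (@scl2 R) x p) p) = 0 by rewrite h.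
rewrite cRe_ip2 !nrm2_ip2 !E.
rewrite (sqnorm_split _ _ _ _ (Lx true) (Lp true)).
rewrite (sqnorm_split _ _ _ _ (Lx false) (Lp false)).
move: (cRe _) (cRe _) (2 * pi)^-1 => u v k uv0.
rewrite -[RHS]addr0 -(mulr0 2) -uv0; ring.
Qed.

(** Multiplication by $z$ preserves the norm, so here the projection loses no norm; by Pythagoras
    the discarded part $zx-p$ is zero. *)
Lemma isproj_zmul S x p : (forall y, S y -> L2pair y) -> S x ->
  isproj (@add2 R) (@scl2 R) (@ip2 R) S (zmul x) p ->
  nrm2 (@ip2 R) p = nrm2 (@ip2 R) x ->
  {ae @lebm R, forall t, circ t -> forall b, component b p t = expi t * component b x t}.
Proof.
move=> SL Sx [Sp orth] e.
have Lz := L2pair_zmul _ (SL _ Sx); have Lp := SL _ Sp.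
have := nrm2_split _ _ Lz Lp (orth _ Sp).
rewrite nrm2_zmul e => h; have {}h : nrm2 (@ip2 R)
  (vsub (@add2 R) (@scl2 R) (zmul x) p) = 0 by lra.
move: h => /(eqv_ae _ _ Lz Lp); apply: filterS => t h ct b.
by rewrite -h// comp_zmul.
Qed.

End ModelSpace.

(** * The Cauchy-type integral of chord-Lipschitz functions *)

Section CauchyTypeIntegral.
Variable R : realType.
Variable mu : probability (measurableTypeR R) R.
Hypothesis mu_circ : mu (~` @circ R) = 0%E.
Implicit Types f g h : R -> R[i].

Let mcirc := @measurable_circ R.

Lemma prob_circ : mu (@circ R) = 1%E.
Proof.
have := probability_setC mu (measurableC mcirc).
by rewrite setCK mu_circ sube0.
Qed.

Lemma prob_circ_fin : (mu (@circ R) < +oo)%E.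
Proof. by rewrite prob_circ ltry. Qed.
Let muf := prob_circ_fin.

Lemma Rintegral_prob_cst a : \int[mu]_(_ in @circ R) a = a.
Proof.
transitivity (a * fine (mu (@circ R))); first exact: Rintegral_cst.
by rewrite prob_circ mulr1.
Qed.

Lemma normr_Rintegral_prob_le u M : rintegrable R mu u ->
  (forall t, circ t -> `|u t| <= M) -> `|\int[mu]_(t in @circ R) u t| <= M.
Proof.
move=> iu uM; apply: (le_trans (le_normr_Rintegral mcirc iu)).
rewrite -[leRHS]Rintegral_prob_cst; apply: le_Rintegral => //.
- exact: integrable_norm.
- exact: rintegrable_cst.
Qed.

Lemma cint_cst a : cint mu (fun=> a) = a.
Proof. by apply: complex_ext => /=; rewrite Rintegral_prob_cst. Qed.

(** The real and imaginary parts of the integral are bounded separately, each with square at most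
    [K]; hence the factor 2. *)
Lemma sqn_cint_le f K : cmeasurable f -> (forall t, circ t -> sqn (f t) <= K) ->
  sqn (cint mu f) <= 2 * K.
Proof.
move=> mf fK; have [i1 i2] := cintegrable_bounded R mu muf f K mf fK.
have c0 : circ (0 : R) by rewrite /circ /= in_itv /= lexx mulr_gt0 ?pi_gt0.
have K0 : 0 <= K by rewrite (le_trans (sqn_ge0 _ (f 0))) ?fK.
have H (u : R -> R) : rintegrable R mu u -> (forall t, circ t -> u t ^+ 2 <= K) ->
    (\int[mu]_(t in @circ R) u t) ^+ 2 <= K.
  move=> iu uK; rewrite -[X in X <= _]real_normK ?num_real//.
  rewrite -[K]sqr_sqrtr// ler_sqr ?nnegrE ?sqrtr_ge0//.
  apply: normr_Rintegral_prob_le => // t ct.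
  by rewrite -sqrtr_sqr ler_sqrt// uK.
rewrite mulr2n mulrDl mul1r lerD//; apply: H => // t ct /=;
  by rewrite (le_trans _ (fK _ ct))// /sqn ?lerDl ?lerDr sqr_ge0.
Qed.

(** Squared difference quotients at most [K], written without division so that the diagonal is no
    exception. Taking chord zero shows that it forces $2\pi$-periodicity. *)
Definition chord_lip K f :=
  forall s t, sqn (f s - f t) <= K * sqn (1 - (expi s)^* * expi t).

(** For these functions the integrand of [Jint] is measurable and bounded, so [Jint] is a genuine
    integral at every point. *)
Definition regular f := cmeasurable f /\ exists2 K, 0 <= K & chord_lip K f.

Lemma sqnV (z : R[i]) : sqn z^-1 = (sqn z)^-1.
Proof.
have [->|z0] := eqVneq z 0; first by rewrite invr0 sqn0 invr0.
have s0 : sqn z != 0 by apply: contra_neq z0 => /sqn_eq0.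
by apply: (mulfI s0); rewrite -sqnM !divff// sqn1.
Qed.

Lemma chord_lip_quot K f s t : 0 <= K -> chord_lip K f ->
  sqn ((f s - f t) / (1 - (expi s)^* * expi t)) <= K.
Proof.
move=> K0 /(_ s t); rewrite sqnM sqnV.
move: (sqn (1 - _)) (sqn_ge0 _ (1 - (expi s)^* * expi t)) => d d0 h.
(* On the diagonal the inverse of 0 is 0, so the quotient is 0. *)
have [->|dn0] := eqVneq d 0; first by rewrite invr0 mulr0.
by rewrite ler_pdivrMr// lt_def dn0.
Qed.

Lemma cmeasurable_quot f t : cmeasurable f ->
  cmeasurable (fun s => (f s - f t) / (1 - (expi s)^* * expi t)).
Proof.
move=> mf; apply: cmeasurableM.
  by apply: cmeasurableB => //; exact: cmeasurable_cst.
apply: cmeasurableV; apply: cmeasurableB; first exact: cmeasurable_cst.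
apply: cmeasurableM; last exact: cmeasurable_cst.
by apply: cmeasurableJ; exact: cmeasurable_expi.
Qed.

Lemma cintegrable_quot f t : regular f ->
  cintegrable R mu (fun s => (f s - f t) / (1 - (expi s)^* * expi t)).
Proof.
move=> [mf [K K0 fK]]; apply: (cintegrable_bounded _ _ muf _ K).
  exact: cmeasurable_quot.
by move=> s _; exact: chord_lip_quot.
Qed.

Lemma sqn_Jint_le K f t : 0 <= K -> cmeasurable f -> chord_lip K f ->
  sqn (Jint mu f t) <= 2 * K.
Proof.
move=> K0 mf fK; apply: sqn_cint_le; first exact: cmeasurable_quot.
by move=> s _; exact: chord_lip_quot.
Qed.

(** A squared chord is at most 4, so $|f(t)-f(0)|^2\le 4K$; adding $f(0)$ back doubles both
    terms. *)
Lemma chord_lip_bounded K f t : 0 <= K -> chord_lip K f ->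
  sqn (f t) <= 8 * K + 2 * sqn (f 0).
Proof.
move=> K0 /(_ t 0); rewrite sqn_chord => h.
rewrite -[f t](subrK (f 0)) (le_trans (sqnD_le _ _ _))// lerD2r.
have -> : 8 * K = 2 * (K * 4) by ring.
rewrite ler_wpM2l// (le_trans h)// ler_wpM2l//.
by have := cos_geN1 (0 - t); lra.
Qed.

Lemma regular_L2 f : regular f -> L2 mu f.
Proof.
move=> [mf [K K0 fK]]; apply: (L2_bounded _ _ muf _ (8 * K + 2 * sqn (f 0))) => //.
by move=> t _; exact: chord_lip_bounded.
Qed.

Lemma regular_lin a f g : regular f -> regular g -> regular (fadd (fscl a f) g).
Proof.
move=> [mf [K K0 fK]] [mg [L L0 gL]]; split.
  by apply: cmeasurableD => //; apply: cmeasurableM => //; exact: cmeasurable_cst.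
exists (2 * (sqn a * K) + 2 * L).
  by rewrite addr_ge0 ?mulr_ge0 ?sqn_ge0.
move=> s t; have -> : fadd (fscl a f) g s - fadd (fscl a f) g t =
    a * (f s - f t) + (g s - g t) by rewrite /fadd /fscl; ring.
rewrite (le_trans (sqnD_le _ _ _))// [leRHS]mulrDl -!mulrA lerD// ler_wpM2l//.
by rewrite sqnM ler_wpM2l ?sqn_ge0.
Qed.

Lemma Jint_lin a f g t : regular f -> regular g ->
  Jint mu (fadd (fscl a f) g) t = a * Jint mu f t + Jint mu g t.
Proof.
move=> rf rg; have qf := cintegrable_quot f t rf; have qg := cintegrable_quot g t rg.
rewrite /Jint -cintZ// -cintD//; last exact: cintegrableZ.
by apply: eq_cint => s _; rewrite /fadd /fscl; ring.
Qed.

Lemma chord_neq0 (s t : R) : circ s -> circ t -> s != t ->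
  1 - (expi s)^* * expi t != 0 :> R[i].
Proof.
rewrite /circ /= !in_itv /= => /andP[s0 sT] /andP[t0 tT] st.
apply/eqP => h; have := sqn_chord R s t; rewrite h sqn0 -cos_norm.
have x0 : 0 < `|t - s| by rewrite normr_gt0 subr_eq0 eq_sym.
have xT : `|t - s| < 2 * pi by rewrite ltr_norml; apply/andP; split; lra.
move: `|t - s| x0 xT => x x0 xT.
have sx : 0 < sin (x / 2) by apply: sin_gt0_pi; apply/andP; split; lra.
have xE : x = (x / 2) *+ 2 by rewrite -mulr_natr divfK// pnatr_eq0.
rewrite {1}xE cos_mulr2n cos2sin2 => c0.
have : 0 < sin (x / 2) ^+ 2 by rewrite exprn_gt0.
lra.
Qed.

(** A probability measure has countably many atoms, and countable sets are Lebesgue null. *)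
Lemma null_atoms : {ae @lebm R, forall t, mu [set t] = 0%E}.
Proof.
have cA : countable [set t : R | (0 < fine (mu [set t]))%R].
  have mid : measurable_fun [set: measurableTypeR R] (id : measurableTypeR R -> R).
    exact: measurable_id.
  (* For the identity random variable, the probability mass function is the mass of atoms. *)
  pose X : {RV mu >-> R} := 
    MeasurableFun.Pack (MeasurableFun.Class (isMeasurableFun.Build _ _ _ _ _ mid)).
  have := pmf_gt0_countable X.
  by apply: sub_countable; apply: subset_card_le => t /=.
exists [set t : R | (0 < fine (mu [set t]))%R]; split.
- by apply: countable_measurable => // t; exact: measurable_set1.
- exact: countable_lebesgue_measure0.
- move=> t /= /eqP mt; rewrite fine_gt0// lt0e mt measure_ge0 /=.
  by rewrite (le_lt_trans (probability_le1 _ _)) ?ltry.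
Qed.

(** This is the inner product $(f,b_1)$, since $b_1=\overline\xi$. *)
Definition moment1 f : R[i] := cint mu (fun s => expi s * f s).

(* At an atom [t] of [mu] the integrand of [Jint] has the junk value [0 / 0 = 0] on a set
   of positive measure, and the identity can fail. *)
Lemma Jint_expi f t : regular f -> regular (fun s => expi s * f s) -> circ t ->
  mu [set t] = 0%E ->
  Jint mu (fun s => expi s * f s) t = moment1 f + expi t * Jint mu f t.
Proof.
move=> rf rg ct mt; have qf := cintegrable_quot f t rf.
have L : cintegrable R mu (fun s => expi s * f s).
  have [mg [K K0 gK]] := rg.
  apply: (cintegrable_bounded _ _ muf _ (8 * K + 2 * sqn (expi 0 * f 0))) => //.
  by move=> s _; exact: (chord_lip_bounded _ _ _ K0 gK).
rewrite /Jint /moment1 -cintZ// -cintD//; last exact: cintegrableZ.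
have qg := cintegrable_quot _ t rg.
have qh := cintegrableD _ _ _ _ L (cintegrableZ _ _ (expi t) _ qf).
(* With $\xi\overline\xi=1$ the numerator is $\xi f(\xi)(1-\overline\xi z)+z(f(\xi)-f(z))$. *)
have E s : circ s -> s <> t ->
    (expi s * f s - expi t * f t) / (1 - (expi s)^* * expi t) =
    expi s * f s + expi t * ((f s - f t) / (1 - (expi s)^* * expi t)).
  move=> cs /eqP st; have d0 := chord_neq0 s t cs ct st.
  apply: (mulIf d0); rewrite divfK// mulrDl -[X in _ = _ + X]mulrA divfK//.
  have := expiM R s; move: (expi s) (expi s)^* (expi t) => x y z xy.
  rewrite mulrBr mulr1 [x * _]mulrC.
  have -> : f s * x * (y * z) = (y * x) * (f s * z) by ring.
  by rewrite xy; ring.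
(* The two integrands can differ only at [s = t], a null set because [t] is not an atom. *)
have H (u v : R -> R) : rintegrable R mu u -> rintegrable R mu v ->
    (forall s, circ s -> s <> t -> u s = v s) ->
    \int[mu]_(s in @circ R) u s = \int[mu]_(s in @circ R) v s.
  move=> iu iv uv; congr fine; apply: ae_eq_integral => //.
  - exact: measurable_int iu.
  - exact: measurable_int iv.
  - exists [set t]; split => // s /= /not_implyP[cs us].
    by apply: contrapT => st; apply: us; rewrite uv.
apply: complex_ext; apply: H.
- by have [] := qg.
- by have [] := qh.
- by move=> s cs st /=; rewrite E.
- by have [] := qg.
- by have [] := qh.
- by move=> s cs st /=; rewrite E.
Qed.

End CauchyTypeIntegral.

(** * The recursion for the unitary map and passage to the limit *)

Section Representation.
Variable R : realType.
Variable mu : probability (measurableTypeR R) R.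
Hypothesis mu_circ : mu (~` @circ R) = 0%E.
Variables (gam : R[i]) (S : V2 R -> Prop) (Phi : (R -> R[i]) -> V2 R) (c c1 : V2 R).
Implicit Types f g h : R -> R[i].
Let ip2 := @ip2 R.
Let eqv2 := eqv (@add2 R) (@scl2 R) ip2.
Hypothesis S_L2 : forall y, S y -> L2pair R y.
Hypothesis Sc : S c.
Hypothesis Sc1 : S c1.
Hypothesis Phi_S : forall f, L2 mu f -> S (Phi f).
Hypothesis Phi_lin : forall a f g, L2 mu f -> L2 mu g ->
  eqv2 (Phi (fadd (fscl a f) g)) (add2 (scl2 a (Phi f)) (Phi g)).
Hypothesis Phi_isom : forall f g, L2 mu f -> L2 mu g -> ip2 (Phi f) (Phi g) = ipmu mu f g.
(** The intertwining relation: the model operator projects $zg$ back to the space, so the image of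
    $U_\gamma f$ is that projection for $g=\Phi f$. *)
Hypothesis Phi_model : forall f, L2 mu f ->
  isproj (@add2 R) (@scl2 R) ip2 S (zmul (Phi f)) (Phi (Ugam mu gam f)).
Hypothesis Phi_b : eqv2 (Phi (@bvec R)) c.
Hypothesis Phi_b1 : eqv2 (Phi (@b1vec R)) c1.

Let muf := prob_circ_fin R mu mu_circ.

Lemma nrm2_Phi f : L2 mu f -> nrm2 ip2 (Phi f) = sqnorm R mu f.
Proof. by move=> Lf; rewrite /nrm2 Phi_isom// /ipmu cint_mul_conj. Qed.

Lemma Phi_lin_ae a f g : L2 mu f -> L2 mu g ->
  {ae @lebm R, forall t, circ t -> forall b, component R b (Phi (fadd (fscl a f) g)) t =
     a * component R b (Phi f) t + component R b (Phi g) t}.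
Proof.
move=> Lf Lg.
have Lfg : L2 mu (fadd (fscl a f) g) by apply: L2_add => //; exact: L2_scl.
have LP h : L2 mu h -> L2pair R (Phi h) by move=> Lh; apply: S_L2; exact: Phi_S.
have Lr : L2pair R (add2 (scl2 a (Phi f)) (Phi g)).
  move=> b; rewrite (_ : component R b _ =
    (fun t => a * component R b (Phi f) t + component R b (Phi g) t)).
    by apply: L2_add; [apply: L2_scl; exact: LP|exact: LP].
  by apply/funext => t; rewrite comp_add2 comp_scl2.
apply: filterS (eqv_ae _ _ _ (LP _ Lfg) Lr (Phi_lin _ _ _ Lf Lg)) => t H ct b.
by rewrite H// comp_add2 comp_scl2.
Qed.

Lemma L2_bvec : L2 mu (@bvec R).
Proof.
apply: (L2_bounded _ _ muf _ 1); first exact: cmeasurable_cst.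
by move=> t _; rewrite sqn1.
Qed.

Lemma L2_b1vec : L2 mu (@b1vec R).
Proof.
apply: (L2_bounded _ _ muf _ 1); first by apply: cmeasurableJ; exact: cmeasurable_expi.
by move=> t _; rewrite sqnJ sqn_expi.
Qed.

Lemma Phi_expi f : L2 mu f ->
  {ae @lebm R, forall t, circ t -> forall b,
     component R b (Phi (fun s => expi s * f s)) t = expi t * component R b (Phi f) t +
       moment1 R mu f * (component R b c t - expi t * component R b c1 t)}.
Proof.
move=> Lf; set a := moment1 R mu f.
have Lb := L2_bvec; have Lb1 := L2_b1vec.
have Lxf : L2 mu (fun s => expi s * f s) by exact: L2_expi.
(* Since $b_1$ is a unit vector, this is the part of [f] orthogonal to it, and the rank one term of
   [Ugam] vanishes on it. *)
pose f0 := fadd (fscl (- a) (@b1vec R)) f.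
have L0 : L2 mu f0 by apply: L2_add => //; exact: L2_scl.
have f0b1 : ipmu mu f0 (@b1vec R) = 0.
  rewrite /ipmu (eq_cint _ _ _ (fun s => (- a) * 1 + expi s * f s)); last first.
    move=> s _; rewrite /f0 /fadd /fscl /b1vec conjCK mulrDl -[in LHS]mulrA expiM.
    by rewrite [f s * _]mulrC.
  rewrite cintD ?cintZ ?cint_cst//.
  - by rewrite mulr1 /a /moment1 addNr.
  - exact: (cintegrable_bounded _ _ muf _ (sqn 1) (cmeasurable_cst _ _)).
  - apply: cintegrableZ.
    exact: (cintegrable_bounded _ _ muf _ (sqn 1) (cmeasurable_cst _ _)).
  - rewrite (_ : (fun _ => _) = (fun s => f s * (b1vec s)^*)); first exact: L2_mul_conj.
    by apply/funext => s; rewrite /b1vec conjCK mulrC.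
have U0 : Ugam mu gam f0 = fun s => expi s * f0 s.
  by apply/funext => s; rewrite /Ugam f0b1 mulr0 mul0r addr0.
(* Multiplication by $\xi$ sends $b_1$ to $b$. *)
have Uf : Ugam mu gam f0 = fadd (fscl (- a) (@bvec R)) (fun s => expi s * f s).
  rewrite U0; apply/funext => s; rewrite /f0 /fadd /fscl /b1vec /bvec mulrDr.
  by rewrite mulrCA [expi s * _^*]mulrC expiM.
have nU : nrm2 ip2 (Phi (Ugam mu gam f0)) = nrm2 ip2 (Phi f0).
  rewrite !nrm2_Phi//; last by rewrite U0; exact: L2_expi.
  by rewrite U0; apply: eq_Rintegral => s _; rewrite sqnM sqn_expi mul1r.
have LP h : L2 mu h -> L2pair R (Phi h) by move=> Lh; apply: S_L2; exact: Phi_S.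
have A1 := isproj_zmul _ _ _ _ S_L2 (Phi_S _ L0) (Phi_model _ L0) nU.
have A2 := Phi_lin_ae (- a) _ _ Lb1 Lf.
have A3 := Phi_lin_ae (- a) _ _ Lb Lxf.
have A4 := eqv_ae _ _ _ (LP _ Lb) (S_L2 _ Sc) Phi_b.
have A5 := eqv_ae _ _ _ (LP _ Lb1) (S_L2 _ Sc1) Phi_b1.
apply: filterS (filterI (filterI A1 (filterI A4 A5)) (filterI A2 A3)).
move=> t [[h1 [h4 h5]] [h2 h3]] ct b.
(* This reads $-ac+\Phi(\xi f)=z(-ac_1+\Phi f)$. *)
have := h1 ct b; rewrite Uf h3// h2// h4// h5// => h.
by rewrite -[LHS](addKr (- a * component R b c t)) h; ring.
Qed.

Definition represents f : Prop :=
  {ae @lebm R, forall t, circ t -> forall b, component R b (Phi f) t =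
     component R b c t * f t +
     (component R b c t - expi t * component R b c1 t) * Jint mu f t}.

Lemma represents_lin a f g : regular R f -> regular R g ->
  represents f -> represents g -> represents (fadd (fscl a f) g).
Proof.
move=> rf rg hf hg.
have L := Phi_lin_ae a _ _ (regular_L2 _ _ mu_circ _ rf) (regular_L2 _ _ mu_circ _ rg).
apply: filterS (filterI L (filterI hf hg)) => t [h [h1 h2]] ct b.
by rewrite h// h1// h2// Jint_lin// /fadd /fscl; ring.
Qed.

(** [Phi_expi] and [Jint_expi] give both sides the same recursion off the atoms. As $z\ne0$, it can
    also be run backwards, which reaches negative frequencies. *)
Lemma represents_expi f : regular R f -> regular R (fun s => expi s * f s) ->
  represents f <-> represents (fun s => expi s * f s).
Proof.
move=> rf rg; have A := Phi_expi _ (regular_L2 _ _ mu_circ _ rf).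
have N := null_atoms R mu.
split=> hf; apply: filterS (filterI N (filterI A hf)) => t [nt [h h1]] ct b.
  by rewrite h// h1// Jint_expi//; ring.
apply: (mulfI (expi_neq0 R t)).
have := h ct b; rewrite h1// Jint_expi// => /esym e.
by rewrite -[LHS](addrK (moment1 R mu f *
  (component R b c t - expi t * component R b c1 t))) e; ring.
Qed.

(** The defect of the formula for [f] equals that for the remainder [h]. The term [Phi h] is small
    in norm by isometry, the rest pointwise by [sqn_Jint_le], so an integrable small majorant
    exists. *)
Lemma represents_approx f :
  (forall e, 0 < e -> exists h p, [/\ regular R h, regular R p,
     represents p, f = fadd (fscl 1 h) p & chord_lip R e h /\
     forall t, circ t -> sqn (h t) <= e]) ->
  represents f.
Proof.
move=> H.
pose F f b t := component R b c t * f t +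
  (component R b c t - expi t * component R b c1 t) * Jint mu f t.
have Lc := S_L2 _ Sc; have Lc1 := S_L2 _ Sc1.
pose W b t := sqn (component R b c t) + sqn (component R b c1 t).
have W0 b t : 0 <= W b t by rewrite addr_ge0 ?sqn_ge0.
have iW b : rintegrable R (@lebm R) (W b) by apply: rintegrableD; apply: L2_sqn.
suff K b : {ae @lebm R, forall t, circ t -> sqn (component R b (Phi f) t - F f b t) <= 0}.
  apply: filterS2 (K true) (K false) => t h1 h2 ct b.
  apply/eqP; rewrite -subr_eq0; apply/eqP/sqn_eq0/eqP; rewrite eq_le sqn_ge0 andbT.
  by case: b; [exact: h1|exact: h2].
apply: ae_le0_of_small_dominated => e e0.
pose w := \int[@lebm R]_(t in @circ R) W b t.
have w0 : 0 <= w by apply: Rintegral_ge0.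
have p0 := pi_gt0 R.
(* Makes the integral of the majorant below at most [e]: its first term contributes at most $4\pi
   d$, its second $20dw$. *)
pose d := e / (4 * pi + 20 * w).
have D0 : 0 < 4 * pi + 20 * w by lra.
have d0 : 0 < d by rewrite divr_gt0.
have [h [p [rh rp hp fE [hl hb]]]] := H d d0.
have Lh := regular_L2 _ _ mu_circ _ rh; have Lp := regular_L2 _ _ mu_circ _ rp.
have LPh := S_L2 _ (Phi_S _ Lh).
have iP : rintegrable R (@lebm R) (fun t => sqn (component R b (Phi h) t)).
  by apply: L2_sqn; exact: LPh.
(* The 20 arises as $2(2+8)$: the two terms of [F h b t] have squared moduli at most $Wd$ and
   $2W\cdot2d$, and each use of [sqnD_le] doubles. *)
exists (fun t => 2 * sqn (component R b (Phi h) t) + 20 * d * W b t); split.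
- by apply: rintegrableD; exact: rintegrableZ.
- move=> t; apply: addr_ge0; apply: mulr_ge0; rewrite ?sqn_ge0 ?W0//.
  by rewrite mulr_ge0// ltW.
- have A := Phi_lin_ae 1 _ _ Lh Lp.
  apply: filterS2 A hp => t hA hp' ct; have [mh _] := rh.
  have -> : component R b (Phi f) t - F f b t = component R b (Phi h) t - F h b t.
    by rewrite fE hA// hp'// /F Jint_lin// /fadd /fscl; ring.
  apply: (le_trans (sqnD_le _ _ _)); rewrite lerD2l sqnN /F.
  have J := sqn_Jint_le _ _ mu_circ _ h t (ltW d0) mh hl.
  have cb := hb t ct.
  have B : sqn (component R b c t - expi t * component R b c1 t) <= 2 * W b t.
    apply: (le_trans (sqnD_le _ _ _)).
    by rewrite sqnN sqnM sqn_expi mul1r -mulrDr.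
  have E1 : sqn (component R b c t * h t) <= W b t * d.
    by rewrite sqnM ler_pM ?sqn_ge0// /W lerDl sqn_ge0.
  have E2 : sqn ((component R b c t - expi t * component R b c1 t) *
      Jint mu h t) <= 2 * W b t * (2 * d).
    by rewrite sqnM ler_pM ?sqn_ge0.
  have := sqnD_le _ (component R b c t * h t)
    ((component R b c t - expi t * component R b c1 t) * Jint mu h t).
  by lra.
- rewrite (RintegralD (@measurable_circ R)); [|exact: rintegrableZ|exact: rintegrableZ].
  rewrite (RintegralZl _ (@measurable_circ R) iP).
  rewrite (RintegralZl _ (@measurable_circ R) (iW b)) -/w.
  have : sqnorm R (@lebm R) (component R b (Phi h)) <= 2 * pi * d.
    apply: (le_trans (sqnorm_le_nrm2 _ _ _)).
    rewrite nrm2_Phi//; apply: ler_wpM2l; first by rewrite mulr_ge0// ltW.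
    rewrite /sqnorm -[leRHS](Rintegral_prob_cst _ _ mu_circ) le_Rintegral//.
    + exact: measurable_circ.
    + exact: L2_sqn.
    + exact: rintegrable_cst.
  rewrite /sqnorm => Ph.
  have eE : e = d * (4 * pi + 20 * w) by rewrite /d divfK// gt_eqF.
  by rewrite [leRHS]eE; move: Ph; lra.
Qed.

(** * From constants to harmonics, trigonometric polynomials and $C^1$ functions *)

Definition reg_represents f := regular R f /\ represents f.

Lemma reg_represents_lin a f g : reg_represents f -> reg_represents g ->
  reg_represents (fadd (fscl a f) g).
Proof.
move=> [rf hf] [rg hg]; split; first exact: regular_lin.
exact: represents_lin.
Qed.

Lemma reg_represents_cst a : reg_represents (fun=> a).
Proof.
have h1 : reg_represents (fun=> 1).
  split.
    split; first exact: cmeasurable_cst.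
    by exists 0 => // s t; rewrite subrr sqn0 mul0r.
  have A := eqv_ae _ _ _ (S_L2 _ (Phi_S _ L2_bvec)) (S_L2 _ Sc) Phi_b.
  rewrite /represents; apply: filterS A => t h ct b; rewrite -/(@bvec R) h//.
  rewrite /Jint (_ : cint _ _ = 0) ?mulr0 ?addr0 ?mulr1//.
  rewrite (_ : (fun _ => _) = (fun=> 0)); first exact: cint_cst.
  by apply/funext => s; rewrite /bvec subrr mul0r.
(* The combination $a\cdot1$ is put in the form $af+g$ by splitting off one copy of 1. *)
rewrite (_ : (fun _ => _) = fadd (fscl (a - 1) (fun=> 1)) (fun=> 1)).
  exact: reg_represents_lin.
by apply/funext => t; rewrite /fadd /fscl mulr1 subrK.
Qed.

(** [chord_lipschitz] costs $4e^2$ for each of the two parts. *)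
Lemma regular_of_derive (u v : R -> R) (e : R) : 0 <= e ->
  (forall t : R, exists2 d : R, is_derive t 1 u d & `|d| <= e) -> periodic u (2 * pi) ->
  (forall t : R, exists2 d : R, is_derive t 1 v d & `|d| <= e) -> periodic v (2 * pi) ->
  chord_lip R (8 * e ^+ 2) (fun t => Complex (u t) (v t)) /\
  regular R (fun t => Complex (u t) (v t)).
Proof.
move=> e0 du pu dv pv.
have L : chord_lip R (8 * e ^+ 2) (fun t => Complex (u t) (v t)).
  move=> s t; rewrite sqn_chord.
  have := @chord_lipschitz _ u e e0 du pu s t.
  have := @chord_lipschitz _ v e e0 dv pv s t.
  rewrite {1}/sqn !cReImE /=; move: (_ ^+ 2) (_ ^+ 2) (2 - _) (e ^+ 2) => x y z w.
  by lra.
split=> //; split; last by exists (8 * e ^+ 2) => //; rewrite mulr_ge0// sqr_ge0.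
have C (w : R -> R) : (forall t : R, exists2 d : R, is_derive t 1 w d & `|d| <= e) ->
    continuous w.
  move=> dw t; have [d hd _] := dw t.
  by apply: differentiable_continuous; apply/derivable1_diffP.
by apply: cmeasurable_continuous; exact: C.
Qed.

Lemma expiD (x y : R) : expi (x + y) = expi x * expi y.
Proof. by apply: complex_ext; rewrite !cReImE /= ?cosD ?sinD //; ring. Qed.

Lemma regular_harmonic (d : int) : regular R (fun t => expi (d%:~R * t)).
Proof.
have [] := @regular_of_derive (fun t => cos (d%:~R * t)) (fun t => sin (d%:~R * t))
  `|d%:~R|; rewrite ?normr_ge0//.
- move=> t; exists (- (d%:~R * sin (d%:~R * t + 0))).
    by under eq_fun do rewrite -[_ * _]addr0; exact: is_derive_cosz.
  by rewrite normrN normrM ler_piMr// sin_max.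
- exact: (trigpoly_periodic _ _ (trigpoly_cos _ d)).
- move=> t; exists (d%:~R * cos (d%:~R * t + 0)).
    by under eq_fun do rewrite -[_ * _]addr0; exact: is_derive_sinz.
  by rewrite normrM ler_piMr// cos_max.
- exact: (trigpoly_periodic _ _ (trigpoly_sin _ d)).
Qed.

(** Induction from the constant 1 in both directions, using the two implications of
    [represents_expi]. *)
Lemma reg_represents_harmonic (d : int) : reg_represents (fun t => expi (d%:~R * t)).
Proof.
split; first exact: regular_harmonic.
have E (k : int) : (fun t => expi ((k + 1)%:~R * t)) =
    (fun t => expi t * expi (k%:~R * t)) :> (R -> R[i]).
  by apply/funext => t; rewrite -expiD intrD; congr expi; ring.
have step (k : int) : represents (fun t => expi (k%:~R * t)) <->
    represents (fun t => expi ((k + 1)%:~R * t)).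
  rewrite E; apply: represents_expi; first exact: regular_harmonic.
  by rewrite -E; exact: regular_harmonic.
elim/int_ind: d => [|n|n].
- rewrite (_ : (fun _ => _) = (fun=> 1)); first by have [] := reg_represents_cst 1.
  by apply/funext => t; rewrite mul0r /expi cos0 sin0.
- by move=> /step; rewrite intS addrC.
- by move=> h; apply/step; rewrite (_ : - n.+1%:Z + 1 = - n%:Z)// intS; ring.
Qed.

(** Euler's formulas reduce cosine and sine to harmonics of frequencies [d] and [- d]. *)
Lemma reg_represents_trigpoly p : trigpoly R p -> reg_represents (fun t => Complex (p t) 0).
Proof.
elim=> [a|a u v _ gu _ gv|d|d].
- exact: reg_represents_cst.
- rewrite (_ : (fun _ => _) = fadd (fscl (Complex a 0) (fun t => Complex (u t) 0))
      (fun t => Complex (v t) 0)).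
    exact: reg_represents_lin.
  by apply/funext => t; apply: complex_ext; rewrite /fadd /fscl !cReImE /=; ring.
- rewrite (_ : (fun _ => _) = fadd (fscl (Complex 2^-1 0) (fun t => expi (d%:~R * t)))
      (fadd (fscl (Complex 2^-1 0) (fun t => expi ((- d)%:~R * t))) (fun=> 0))).
    do 2 (apply: reg_represents_lin; first exact: reg_represents_harmonic).
    exact: reg_represents_cst.
  apply/funext => t; rewrite /fadd /fscl mulrNz mulNr.
  by apply: complex_ext; rewrite !cReImE /= cosN ?sinN; field.
- rewrite (_ : (fun _ => _) = fadd (fscl (Complex 0 (- 2^-1)) (fun t => expi (d%:~R * t)))
      (fadd (fscl (Complex 0 2^-1) (fun t => expi ((- d)%:~R * t))) (fun=> 0))).
    do 2 (apply: reg_represents_lin; first exact: reg_represents_harmonic).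
    exact: reg_represents_cst.
  apply/funext => t; rewrite /fadd /fscl mulrNz mulNr.
  by apply: complex_ext; rewrite !cReImE /= cosN ?sinN; field.
Qed.

Lemma represents_C1 f : C1T f -> represents f.
Proof.
move=> [pf [du [cu [dv cv]]]]; apply: represents_approx => e e0.
(* The chord constant of [h] is then $8d^2=e/8$, and since [h] vanishes at 0 its squared modulus is
   at most $8\cdot8d^2=e$. *)
pose d := Num.sqrt (e / 64).
have d2 : d ^+ 2 = e / 64 by rewrite sqr_sqrtr// divr_ge0// ltW.
have d0 : 0 < d by rewrite sqrtr_gt0 divr_gt0.
have pu : periodic (@cRe R \o f) (2 * pi) by move=> t /=; rewrite pf.
have pv : periodic (@cIm R \o f) (2 * pi) by move=> t /=; rewrite pf.
have [p [tp p0 dp]] := @trig_approx R _ d d0 du cu pu.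
have [q [tq q0 dq]] := @trig_approx R _ d d0 dv cv pv.
pose h t := Complex (cRe (f t) - p t) (cIm (f t) - q t).
have [||hl hr] := @regular_of_derive (fun t => cRe (f t) - p t)
  (fun t => cIm (f t) - q t) d (ltW d0) dp _ dq.
- by move=> t; rewrite pf trigpoly_periodic.
- by move=> t; rewrite pf trigpoly_periodic.
have [gp1 gp2] : reg_represents (fun t => Complex (p t) (q t)).
  rewrite (_ : (fun _ => _) = fadd (fscl (Complex 0 1) (fun t => Complex (q t) 0))
      (fun t => Complex (p t) 0)).
    by apply: reg_represents_lin; exact: reg_represents_trigpoly.
  by apply/funext => t; apply: complex_ext; rewrite /fadd /fscl !cReImE /=; ring.
have h0 : h 0 = 0.
  by rewrite /h p0 q0 /= !subrr.
exists h, (fun t => Complex (p t) (q t)); split => //.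
- apply/funext => t; rewrite /fadd /fscl mul1r /h.
  by apply: complex_ext; rewrite !cReImE /= subrK.
- split=> [s t|t _].
    rewrite (le_trans (hl s t))// ler_wpM2r ?sqn_ge0// d2; lra.
  have K0 : 0 <= 8 * d ^+ 2 by rewrite mulr_ge0 ?sqr_ge0.
  have := chord_lip_bounded _ _ h t K0 hl; rewrite h0 sqn0 d2; lra.
Qed.

End Representation.

(** * The representation formula in the Sz.-Nagy-Foias model space *)

Theorem theorem4p1 (R : realType)
  (mu : probability (measurableTypeR R) R)
  (gam : R[i]) (th : R -> R[i])
  (M : V2 R -> V2 R) (Phi : (R -> R[i]) -> V2 R) (c c1 : V2 R) :
  (* mu is a Borel probability measure on T (angles in [0, 2 pi[) *)
  mu (~` @circ R) = 0%E ->
  sqn gam < 1 ->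
  (* th is the a.e. boundary function of theta_gamma; Delta = (1 - |th|^2)^(1/2) *)
  is_boundary mu gam th ->
  (* M is the model operator P_K M_z restricted to K_theta *)
  (forall g, Kth th (Deltaf th) g ->
     isproj (@add2 R) (@scl2 R) (@ip2 R) (Kth th (Deltaf th)) (zmul g) (M g)) ->
  (* c, c1 unit vectors in the defect spaces of M^* and M *)
  defect_star (@add2 R) (@scl2 R) (@ip2 R) (Kth th (Deltaf th)) M c ->
  defect (@add2 R) (@scl2 R) (@ip2 R) (Kth th (Deltaf th)) M c1 ->
  nrm2 (@ip2 R) c = 1 -> nrm2 (@ip2 R) c1 = 1 ->
  (* Phi : L^2(mu) -> K_theta unitary *)
  (forall f, L2 mu f -> Kth th (Deltaf th) (Phi f)) ->
  (forall a f g, L2 mu f -> L2 mu g ->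
     eqv (@add2 R) (@scl2 R) (@ip2 R)
       (Phi (fadd (fscl a f) g)) (add2 (scl2 a (Phi f)) (Phi g))) ->
  (forall f g, L2 mu f -> L2 mu g -> ip2 (Phi f) (Phi g) = ipmu mu f g) ->
  (forall y, Kth th (Deltaf th) y ->
     exists2 f, L2 mu f & eqv (@add2 R) (@scl2 R) (@ip2 R) (Phi f) y) ->
  (* Phi U_gamma = M Phi *)
  (forall f, L2 mu f ->
     isproj (@add2 R) (@scl2 R) (@ip2 R) (Kth th (Deltaf th))
       (zmul (Phi f)) (Phi (Ugam mu gam f))) ->
  (* Phi b = c, Phi b1 = c1 *)
  eqv (@add2 R) (@scl2 R) (@ip2 R) (Phi (@bvec R)) c ->
  eqv (@add2 R) (@scl2 R) (@ip2 R) (Phi (@b1vec R)) c1 ->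
  forall f : R -> R[i], C1T f ->
  {ae @lebm R, forall t, @circ R t ->
     (Phi f).1 t = c.1 t * f t + (c.1 t - expi t * c1.1 t) * Jint mu f t /\
     (Phi f).2 t = c.2 t * f t + (c.2 t - expi t * c1.2 t) * Jint mu f t}.

Proof.
move=> mu_circ _ _ _ [Sc _] [Sc1 _] _ _ Phi_S Phi_lin Phi_isom _ Phi_model Phi_b Phi_b1 f Cf.
have S_L2 y : Kth th (Deltaf th) y -> L2pair R y.
  by move=> [[h1 _] [h2 _]] [].
have := represents_C1 R mu mu_circ gam (Kth th (Deltaf th)) Phi c c1 S_L2 Sc Sc1
  Phi_S Phi_lin Phi_isom Phi_model Phi_b Phi_b1 f Cf.
by apply: filterS => t h ct; split; [exact: (h ct true)|exact: (h ct false)].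
Qed.
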